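(* Let $\xi\in\mathfrak{h}^*/\mathbb{Z}R$ be of zero central charge and integral, that is, $\lambda(h)\in\mathbb{Z}$ for some (equivalently, all) $\lambda\in\xi$. (i) Let $\lambda\in\xi$ be such that $\lambda(h)=n\in\mathbb{Z}$. Then $\Gamma_n$ is the Gabriel quiver of the category $\mathcal{O}[\xi,\lambda]$. (ii) The quiver $\Gamma$ is the Gabriel quiver of the category $\mathcal{O}[\xi]$. Here the vertex $i\in\mathbb{Z}$ corresponds to the simple module $L(ih^\vee)$.
   Context: The Schrödinger algebra $\mathfrak{s}$ is the complex Lie algebra with basis $e,h,f,p,q,z$, with $z$ central and the remaining brackets $[h,e]=2e$, $[e,f]=h$, $[h,f]=-2f$, $[e,q]=p$, $[e,p]=0$, $[h,p]=p$, $[f,p]=q$, $[f,q]=0$, $[h,q]=-q$, $[p,q]=z$. Put $U=U(\mathfrak{s})$, $\mathfrak{h}=\mathbb{C}h\oplus\mathbb{C}z$, $\mathfrak{n}_+=\mathbb{C}e\oplus\mathbb{C}p$, $\mathfrak{b}=\mathfrak{h}\oplus\mathfrak{n}_+$. Let $\{h^\vee,z^\vee\}\subset\mathfrak{h}^*$ be the basis dual to $\{h,z\}$, and $R=\{\pm h^\vee,\pm 2h^\vee\}$, so $\mathbb{Z}R=\mathbb{Z}h^\vee$. For a $U$-module $M$ and $\lambda\in\mathfrak{h}^*$ let $M_\lambda=\{v\in M: Hv=\lambda(H)v\ \forall H\in\mathfrak{h}\}$; $M$ is a weight module if $M=\bigoplus_\lambda M_\lambda$; its support is the set of $\lambda$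 with $M_\lambda\ne0$. Category $\mathcal{O}$ is the full subcategory of the category of $U$-modules consisting of the finitely generated weight modules $M$ with $\dim U(\mathfrak{n}_+)v<\infty$ for all $v\in M$. The Verma module is $\Delta(\lambda)=U\otimes_{U(\mathfrak{b})}\mathbb{C}_\lambda$, where $\mathfrak{n}_+$ acts on the one-dimensional module $\mathbb{C}_\lambda$ by $0$ and $\mathfrak{h}$ acts via $\lambda$; $L(\lambda)$ is its unique simple quotient. For a coset $\xi\in\mathfrak{h}^*/\mathbb{Z}R$, $\mathcal{O}[\xi]$ is the full subcategory of $\mathcal{O}$ of modules with support contained in $\xi$; the value $\lambda(z)$, independent of $\lambda\in\xi$, is the central charge of $\xi$. If $\xi$ has zero central charge and $\lambda\in\xi$, then $\mathcal{O}[\xi,\lambda]$ is the full subcategory of $\mathcal{O}[\xi]$ of modules $M$ with $M_{\lambda+ih^\vee}=0$ for all integers $i\ge1$. The Gabriel quiver of such a category has as vertices the isomorphism classes of simple objects, and the number of arrows from $L$ to $L'$ is $\dim\mathrm{Ext}^1(L,L')$ (computed in the category). The quiver $\Gamma$ has vertex set $\mathbb{Z}$ and exactly the following arrows: for each $i\in\mathbb{Z}$ with $i\neq0$, one arrow $i\to i-1$ and one arrow $i-1\to i$; and for each integer $i\ge0$, one arrow $i\to -i-2$ and one arrow $-i-2\to i$. (In particular there are no arrows between $0$ and $-1$.) For $n\in\mathbb{Z}$, $\Gamma_n$ is the full subquiver of $\Gamma$ on the vertices $m\in\mathbb{Z}$ with $m\le n$. *)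

(* Defs.v *)
From HB Require Import structures.
From mathcomp Require Import all_boot all_order all_algebra.
From mathcomp Require Import boolp reals.
From mathcomp Require Import complex.
From mathcomp Require Import finmap monalg.

Set Implicit Arguments.
Unset Strict Implicit.
Unset Printing Implicit Defensive.

Import GRing.Theory Num.Theory.
Local Open Scope ring_scope.
Local Open Scope quotient_scope.

(** * Generated substructures and quotients *)

Inductive ideal_gen (A : pzRingType) (S : A -> Prop) : A -> Prop :=
| ideal_gen_in x of S x : ideal_gen S x
| ideal_gen0 : ideal_gen S 0
| ideal_genB x y of ideal_gen S x & ideal_gen S y : ideal_gen S (x - y)
| ideal_genMl a x of ideal_gen S x : ideal_gen S (a * x)
| ideal_genMr a x of ideal_gen S x : ideal_gen S (x * a).

Inductive submod_gen (A : pzRingType) (V : lmodType A) (S : V -> Prop) :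
  V -> Prop :=
| submod_gen_in v of S v : submod_gen S v
| submod_gen0 : submod_gen S 0
| submod_genP a u v of submod_gen S u & submod_gen S v :
    submod_gen S (a *: u + v).

Inductive subalg_gen (K : pzRingType) (A : algType K) (S : A -> Prop) :
  A -> Prop :=
| subalg_gen_in x of S x : subalg_gen S x
| subalg_gen1 : subalg_gen S 1
| subalg_genP c x y of subalg_gen S x & subalg_gen S y :
    subalg_gen S (c *: x + y)
| subalg_genM x y of subalg_gen S x & subalg_gen S y : subalg_gen S (x * y).

Section AlgebraQuotient.
Variables (K : pzRingType) (A : algType K) (S : A -> Prop).

Definition ideal_pred : {pred A} := fun x => `[< ideal_gen S x >].

Fact ideal_pred_closed : zmod_closed ideal_pred.
Proof.
split; first by apply/asboolP; exact: ideal_gen0.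
by move=> x y /asboolP hx /asboolP hy; apply/asboolP; exact: ideal_genB.
Qed.
HB.instance Definition _ := GRing.isZmodClosed.Build A ideal_pred ideal_pred_closed.

(* The algebra A / (S), where (S) is the two-sided ideal generated by S. *)
Definition alg_quot : Type := Quotient.quot (ideal_pred : zmodClosed A).
HB.instance Definition _ := GRing.Zmodule.on alg_quot.
HB.instance Definition _ := EqQuotient.on alg_quot.

Definition alg_pi (x : A) : alg_quot := \pi_alg_quot x.

Lemma alg_piP x y : alg_pi x = alg_pi y <-> ideal_gen S (x - y).
Proof.
split=> [/eqP|h]; last (apply/eqP; move: h).
  by rewrite -Quotient.idealrBE => /asboolP.
by move=> h; rewrite -Quotient.idealrBE; apply/asboolP.
Qed.

Lemma alg_piK q : alg_pi (repr q) = q. Proof. exact: reprK. Qed.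

Fact alg_piB x y : alg_pi (x - y) = alg_pi x - alg_pi y.
Proof. by rewrite /alg_pi !piE. Qed.
Fact alg_piD x y : alg_pi (x + y) = alg_pi x + alg_pi y.
Proof. by rewrite /alg_pi !piE. Qed.

Fact alg_pi0 : alg_pi 0 = 0.
Proof. by rewrite -(subrr 0) alg_piB subrr. Qed.

Definition alg_quot_mul (p q : alg_quot) : alg_quot := alg_pi (repr p * repr q).
Definition alg_quot_scale (c : K) (q : alg_quot) : alg_quot :=
  alg_pi (c *: repr q).

Fact alg_repr x : ideal_gen S (repr (alg_pi x) - x).
Proof. by apply/alg_piP; rewrite alg_piK. Qed.

Fact ideal_genD x y : ideal_gen S x -> ideal_gen S y -> ideal_gen S (x + y).
Proof.
move=> hx hy; rewrite -[y]opprK; apply: ideal_genB => //.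
by rewrite -sub0r; apply: ideal_genB => //; exact: ideal_gen0.
Qed.

Fact alg_piM x y : alg_pi (x * y) = alg_quot_mul (alg_pi x) (alg_pi y).
Proof.
apply/esym/alg_piP; set x' := repr _; set y' := repr _.
rewrite -[x' * y'](addrNK (x * y')) -addrA -mulrBl -mulrBr.
by apply: ideal_genD; [apply: ideal_genMr|apply: ideal_genMl]; exact: alg_repr.
Qed.

Fact alg_piZ c x : alg_pi (c *: x) = alg_quot_scale c (alg_pi x).
Proof.
apply/esym/alg_piP; rewrite -scalerBr -mulr_algl.
by apply: ideal_genMl; exact: alg_repr.
Qed.

Local Ltac lift_repr := repeat match goal with q : alg_quot |- _ =>
  rewrite -[q]alg_piK; move: (repr q) => {}q end.

Fact alg_quot_mulA : associative alg_quot_mul.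
Proof. by move=> x y z; lift_repr; rewrite -!alg_piM mulrA. Qed.
Fact alg_quot_mul1 : left_id (alg_pi 1) alg_quot_mul.
Proof. by move=> x; lift_repr; rewrite -!alg_piM mul1r. Qed.
Fact alg_quot_mulr1 : right_id (alg_pi 1) alg_quot_mul.
Proof. by move=> x; lift_repr; rewrite -!alg_piM mulr1. Qed.
Fact alg_quot_mulDl : left_distributive alg_quot_mul +%R.
Proof.
by move=> x y z; lift_repr; rewrite -?(alg_piM, alg_piD) mulrDl.
Qed.
Fact alg_quot_mulDr : right_distributive alg_quot_mul +%R.
Proof.
by move=> x y z; lift_repr; rewrite -?(alg_piM, alg_piD) mulrDr.
Qed.
HB.instance Definition _ := GRing.Zmodule_isPzRing.Build alg_quot
  alg_quot_mulA alg_quot_mul1 alg_quot_mulr1 alg_quot_mulDl alg_quot_mulDr.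

Fact alg_quot_scaleA a b q :
  alg_quot_scale a (alg_quot_scale b q) = alg_quot_scale (a * b) q.
Proof. by lift_repr; rewrite -!alg_piZ scalerA. Qed.
Fact alg_quot_scale1 : left_id 1 alg_quot_scale.
Proof. by move=> q; lift_repr; rewrite -!alg_piZ scale1r. Qed.
Fact alg_quot_scaleDr : right_distributive alg_quot_scale +%R.
Proof.
by move=> c p q; lift_repr; rewrite -?(alg_piZ, alg_piD) scalerDr.
Qed.
Fact alg_quot_scaleDl q : {morph alg_quot_scale^~ q : a b / a + b}.
Proof. by move=> a b; lift_repr; rewrite -?(alg_piZ, alg_piD) scalerDl. Qed.
HB.instance Definition _ := GRing.Zmodule_isLmodule.Build K alg_quot
  alg_quot_scaleA alg_quot_scale1 alg_quot_scaleDr alg_quot_scaleDl.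

Fact alg_quot_scaleAl (c : K) (p q : alg_quot) : c *: (p * q) = (c *: p) * q.
Proof.
by lift_repr; rewrite /GRing.mul /GRing.scale /= -?(alg_piM, alg_piZ) scalerAl.
Qed.

Fact alg_quot_scaleAr (c : K) (p q : alg_quot) : c *: (p * q) = p * (c *: q).
Proof.
by lift_repr; rewrite /GRing.mul /GRing.scale /= -?(alg_piM, alg_piZ) scalerAr.
Qed.

End AlgebraQuotient.

Section ModuleQuotient.
Variables (A : pzRingType) (V : lmodType A) (S : V -> Prop).

Definition submod_pred : {pred V} := fun x => `[< submod_gen S x >].

Fact submod_pred_closed : zmod_closed submod_pred.
Proof.
split; first by apply/asboolP; exact: submod_gen0.
move=> x y /asboolP hx /asboolP hy; apply/asboolP.
by rewrite addrC -scaleN1r; exact: submod_genP.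
Qed.
HB.instance Definition _ :=
  GRing.isZmodClosed.Build V submod_pred submod_pred_closed.

(* The module V / <S>, where <S> is the submodule generated by S. *)
Definition mod_quot : Type := Quotient.quot (submod_pred : zmodClosed V).
HB.instance Definition _ := GRing.Zmodule.on mod_quot.
HB.instance Definition _ := EqQuotient.on mod_quot.

Definition mod_pi (x : V) : mod_quot := \pi_mod_quot x.

Lemma mod_piP x y : mod_pi x = mod_pi y <-> submod_gen S (x - y).
Proof.
split=> [/eqP|h]; last (apply/eqP; move: h).
  by rewrite -Quotient.idealrBE => /asboolP.
by move=> h; rewrite -Quotient.idealrBE; apply/asboolP.
Qed.

Lemma mod_piK q : mod_pi (repr q) = q. Proof. exact: reprK. Qed.

Fact mod_piD x y : mod_pi (x + y) = mod_pi x + mod_pi y.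
Proof. by rewrite /mod_pi !piE. Qed.

Definition mod_quot_scale (a : A) (q : mod_quot) : mod_quot :=
  mod_pi (a *: repr q).

Fact mod_piZ a x : mod_pi (a *: x) = mod_quot_scale a (mod_pi x).
Proof.
apply/esym/mod_piP; rewrite -scalerBr -[_ *: _]addr0.
apply: submod_genP; last exact: submod_gen0.
by apply/mod_piP; rewrite mod_piK.
Qed.

Local Ltac lift_repr := repeat match goal with q : mod_quot |- _ =>
  rewrite -[q]mod_piK; move: (repr q) => {}q end.

Fact mod_quot_scaleA a b q :
  mod_quot_scale a (mod_quot_scale b q) = mod_quot_scale (a * b) q.
Proof. by lift_repr; rewrite -!mod_piZ scalerA. Qed.
Fact mod_quot_scale1 : left_id 1 mod_quot_scale.
Proof. by move=> q; lift_repr; rewrite -!mod_piZ scale1r. Qed.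
Fact mod_quot_scaleDr : right_distributive mod_quot_scale +%R.
Proof.
by move=> c p q; lift_repr; rewrite -?(mod_piZ, mod_piD) scalerDr.
Qed.
Fact mod_quot_scaleDl q : {morph mod_quot_scale^~ q : a b / a + b}.
Proof. by move=> a b; lift_repr; rewrite -?(mod_piZ, mod_piD) scalerDl. Qed.
HB.instance Definition _ := GRing.Zmodule_isLmodule.Build A mod_quot
  mod_quot_scaleA mod_quot_scale1 mod_quot_scaleDr mod_quot_scaleDl.

Fact mod_pi_linear : linear mod_pi.
Proof. by move=> a x y; rewrite mod_piD mod_piZ. Qed.
HB.instance Definition _ := GRing.isLinear.Build A V mod_quot _ mod_pi
  mod_pi_linear.

(* Homomorphism theorem. *)
Lemma mod_quot_lift (M : lmodType A) (g : {linear V -> M}) :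
  (forall s, S s -> g s = 0) ->
  exists f : {linear mod_quot -> M}, forall x, f (mod_pi x) = g x.
Proof.
move=> gS.
have gW x : submod_gen S x -> g x = 0.
  elim=> [s /gS//||a u v _ hu _ hv]; first exact: linear0.
  by rewrite linearP hu hv scaler0 addr0.
pose f (q : mod_quot) := g (repr q).
have fE x : f (mod_pi x) = g x.
  apply/eqP; rewrite -subr_eq0 -linearB; apply/eqP/gW/mod_piP.
  by rewrite mod_piK.
have fL : linear f.
  move=> a p q; rewrite -[p]mod_piK -[q]mod_piK -[X in f X](linearP mod_pi).
  by rewrite !fE linearP.
pose F := GRing.isLinear.Build A mod_quot M _ f fL.
by exists (HB.pack_for {linear mod_quot -> M} f F) => x; exact: fE.
Qed.

End ModuleQuotient.

(** * Module categories *)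

Section Categories.
Variables (K : fieldType) (A : algType K).

Definition iso (M N : lmodType A) : Prop :=
  exists f : {linear M -> N}, bijective f.

(* K-linear span of s; the scalar c : K acts on an A-module as c%:A. *)
Definition in_span (M : lmodType A) (s : seq M) (x : M) : Prop :=
  exists c : 'I_(size s) -> K, x = \sum_(i < size s) (c i)%:A *: s`_i.

Definition fin_gen (M : lmodType A) : Prop :=
  exists s : seq M, forall x, submod_gen (fun y => y \in s) x.

Definition submodule (M : lmodType A) (N : M -> Prop) : Prop :=
  N 0 /\ forall a x y, N x -> N y -> N (a *: x + y).

(* A full subcategory of A-modules is given by its class of objects Cat. *)
Definition simple_object (Cat : lmodType A -> Prop) (M : lmodType A) : Prop :=
  [/\ Cat M, exists x : M, x != 0 &
    forall N, Cat N -> forall f : {linear N -> M}, injective f ->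
      (forall x, f x = 0) \/ (forall y, exists x, f x = y)].

(* Short exact sequences 0 -> Y -> mid -> X -> 0. *)
Record extension (X Y : lmodType A) := Extension {
  mid : lmodType A;
  inc : {linear Y -> mid};
  prj : {linear mid -> X};
  inc_inj : injective inc;
  prj_surj : forall x, exists m, prj m = x;
  inc_prj_exact : forall m, prj m = 0 <-> exists y, inc y = m }.

(* Some morphism E -> E' induces b on the left and a on the right.  With
   a = id (resp. b = id) this says that E' is the pushout of E along b
   (resp. that E is the pullback of E' along a). *)
Definition ext_hom (X Y X' Y' : lmodType A)
    (E : extension X Y) (E' : extension X' Y') (b : Y -> Y') (a : X -> X') :=
  exists f : {linear mid E -> mid E'},
    (forall y, f (inc E y) = inc E' (b y)) /\
    (forall m, prj E' (f m) = a (prj E m)).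

Definition ext_eq (X Y : lmodType A) (E E' : extension X Y) : Prop :=
  ext_hom E E' id id.

Section DirectSum.
Variables (X Y X' Y' : lmodType A) (f : {linear X -> X'}) (g : {linear Y -> Y'}).
Definition prod_map (u : X * Y) : X' * Y' := (f u.1, g u.2).
Fact prod_map_linear : linear prod_map.
Proof. by move=> a [x y] [x' y']; rewrite /prod_map /= !linearP. Qed.
HB.instance Definition _ := GRing.isLinear.Build A (X * Y)%type (X' * Y')%type _
  prod_map prod_map_linear.
End DirectSum.

Section ExtSum.
Variables (X Y X' Y' : lmodType A) (E : extension X Y) (E' : extension X' Y').
Fact ext_sum_inj : injective (prod_map (inc E) (inc E')).
Proof. by move=> [x y] [x' y'] [] /inc_inj -> /inc_inj ->. Qed.
Fact ext_sum_surj x : exists m, prod_map (prj E) (prj E') m = x.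
Proof.
case: x => x x'; have [[m <-] [m' <-]] := (prj_surj E x, prj_surj E' x').
by exists (m, m').
Qed.
Fact ext_sum_exact m : prod_map (prj E) (prj E') m = 0 <->
  exists y, prod_map (inc E) (inc E') y = m.
Proof.
case: m => m m'; split=> [[] |[[y y']] [<- <-]].
  by move=> /inc_prj_exact[y <-] /inc_prj_exact[y' <-]; exists (y, y').
by congr pair; apply/inc_prj_exact; [exists y|exists y'].
Qed.
Definition ext_sum : extension (X * X')%type (Y * Y')%type :=
  Extension ext_sum_inj ext_sum_surj ext_sum_exact.
End ExtSum.

(* E3 is the Baer sum of E1 and E2: pull E1 (+) E2 back along the diagonal of
   X, then push out along the sum map Y (+) Y -> Y. *)
Definition baer_sum (Cat : lmodType A -> Prop) (X Y : lmodType A)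
    (E1 E2 E3 : extension X Y) : Prop :=
  exists P : extension X (Y * Y)%type,
    [/\ Cat (mid P),
        ext_hom P (ext_sum E1 E2) id (fun x => (x, x)) &
        ext_hom P E3 (fun y => y.1 + y.2) id].

Definition ext_scale (X Y : lmodType A) (c : K) (E E' : extension X Y) : Prop :=
  ext_hom E E' (fun y => c%:A *: y) id.

(* dim_K Ext^1(X, Y) = k in Cat: the Yoneda classes of extensions of X by Y
   with middle term in Cat, with Baer sum and pushout along scalars, form a
   vector space isomorphic to K^k. *)
Definition ext1_dim (Cat : lmodType A -> Prop) (X Y : lmodType A) (k : nat) :
    Prop :=
  exists F : 'rV[K]_k -> extension X Y,
    (forall u, Cat (mid (F u))) /\
    [/\ forall u v, baer_sum Cat (F u) (F v) (F (u + v)),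
        forall c u, ext_scale c (F u) (F (c *: u)),
        forall u v, ext_eq (F u) (F v) -> u = v &
        forall E, Cat (mid E) -> exists u, ext_eq E (F u)].

End Categories.

(* A quiver with finitely many arrows between any two vertices, given by the
   number of arrows. *)
Record quiver := Quiver { vertex : Type; arrows : vertex -> vertex -> nat }.

Definition full_subquiver (Q : quiver) (P : pred (vertex Q)) : quiver :=
  {| vertex := {v : vertex Q | P v};
     arrows := fun v w => arrows (sval v) (sval w) |}.

(* Q is the Gabriel quiver of Cat, the vertex v corresponding to the simple
   object S v. *)
Definition gabriel_quiver (K : fieldType) (A : algType K)
    (Cat : lmodType A -> Prop) (Q : quiver) (S : vertex Q -> lmodType A) : Prop :=
  [/\ forall v, simple_object Cat (S v),
      forall v w, iso (S v) (S w) -> v = w,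
      forall M, simple_object Cat M -> exists v, iso M (S v) &
      forall v w, ext1_dim Cat (S v) (S w) (arrows v w)].

(** * The Schroedinger algebra *)

Inductive sbasis := Be | Bh | Bf | Bp | Bq | Bz.

Definition sbasis_code (x : sbasis) : 'I_6 :=
  inord (match x with Be => 0 | Bh => 1 | Bf => 2 | Bp => 3 | Bq => 4 | Bz => 5 end).
Definition sbasis_decode (i : 'I_6) : sbasis :=
  match val i with 0 => Be | 1 => Bh | 2 => Bf | 3 => Bp | 4 => Bq | _ => Bz end.
Fact sbasis_codeK : cancel sbasis_code sbasis_decode.
Proof. by case; rewrite /sbasis_decode /= inordK. Qed.
HB.instance Definition _ := Countable.copy sbasis (can_type sbasis_codeK).
HB.instance Definition _ : isFinite sbasis := CanIsFinite sbasis_codeK.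

Section FreeAlgebra.
Variables (K : comNzRingType) (I : choiceType).

Definition free_alg : Type := {malg K[{fmonom I}]}.
HB.instance Definition _ := GRing.Lalgebra.on free_alg.

Definition free_gen (i : I) : free_alg := << fmu i >>.

Fact free_alg_scaleAr (c : K) (x y : free_alg) : c *: (x * y) = x * (c *: y).
Proof.
rewrite (malgMEw (fsubset_refl (msupp x)) (msuppZ_le c y)) malgME !scaler_sumr.
apply: eq_bigr => k1 _; rewrite scaler_sumr; apply: eq_bigr => k2 _.
by apply/malgP => k; rewrite mcoeffZ !mcoeffU mcoeffZ mulrnAr mulrCA.
Qed.
HB.instance Definition _ := GRing.Lalgebra_isAlgebra.Build K free_alg
  free_alg_scaleAr.

Definition free_counit (x : free_alg) : K :=
  mcoeff (mone : {fmonom I}) (x : {malg K[{fmonom I}]}).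
HB.instance Definition _ :=
  GRing.RMorphism.copy free_counit (mcoeff (mone : {fmonom I}) : {malg K[{fmonom I}]} -> K).
Fact free_counitZ c x : free_counit (c *: x) = c * free_counit x.
Proof. exact: mcoeffZ. Qed.
Fact free_counit_gen i : free_counit (free_gen i) = 0.
Proof.
by rewrite [LHS]mcoeffU; case: eqP => // /(congr1 (@fdeg I)); rewrite fdegU fdeg1.
Qed.
End FreeAlgebra.

Section Schroedinger.
Variable K : fieldType.

(* The underlying vector space of the Lie algebra, in coordinates. *)
Local Notation schr := {ffun sbasis -> K}.
Definition sbas (x : sbasis) : schr := [ffun y => (y == x)%:R : K].

(* Each unordered pair of basis vectors with nonzero bracket is listed in one
   order only. *)
Definition sbracket_half (x y : sbasis) : schr :=
  match x, y with
  | Bh, Be => sbas Be *+ 2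
  | Be, Bf => sbas Bh
  | Bh, Bf => - (sbas Bf *+ 2)
  | Be, Bq => sbas Bp
  | Bh, Bp => sbas Bp
  | Bf, Bp => sbas Bq
  | Bh, Bq => - sbas Bq
  | Bp, Bq => sbas Bz
  | _, _ => 0
  end.
Definition sbracket (x y : sbasis) : schr :=
  sbracket_half x y - sbracket_half y x.

Local Notation T := (free_alg K sbasis).
Definition schr_tensor (v : schr) : T := \sum_x v x *: free_gen K x.

Definition schr_rel (r : T) : Prop := exists x y : sbasis,
  r = free_gen K x * free_gen K y - free_gen K y * free_gen K x
      - schr_tensor (sbracket x y).

(* The enveloping algebra U(s): the free (tensor) algebra on the basis modulo
   the two-sided ideal generated by the elements xy - yx - [x, y]. *)
Definition U : Type := alg_quot schr_rel.
HB.instance Definition _ := GRing.PzRing.on U.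
HB.instance Definition _ := GRing.Lmodule.on U.

Fact schr_env_neq0 : (1 : U) != 0.
Proof.
have pi1 : 1 = alg_pi schr_rel 1 by [].
apply/eqP; rewrite pi1 -(alg_pi0 schr_rel) => /alg_piP; rewrite subr0.
suff h (x : T) : ideal_gen schr_rel x -> free_counit x = 0.
  by move=> /h /eqP; rewrite rmorph1 oner_eq0.
elim=> [{}x [a [b ->]]||y z _ hy _ hz|a y _ hy|a y _ hy].
- rewrite !rmorphB !rmorphM /= !free_counit_gen !mul0r.
  rewrite [X in _ - _ - X]raddf_sum big1 ?subrr // => i _.
  by rewrite [LHS]free_counitZ free_counit_gen mulr0.
- exact: rmorph0.
- by rewrite rmorphB /= hy hz subrr.
- by rewrite rmorphM /= hy mulr0.
- by rewrite rmorphM /= hy mul0r.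
Qed.
HB.instance Definition _ := GRing.PzSemiRing_isNonZero.Build U schr_env_neq0.
HB.instance Definition _ := GRing.LSemiModule_isLSemiAlgebra.Build K U
  (@alg_quot_scaleAl _ _ schr_rel).
HB.instance Definition _ := GRing.LSemiAlgebra_isSemiAlgebra.Build K U
  (@alg_quot_scaleAr _ _ schr_rel).

Definition sgen (x : sbasis) : U := alg_pi schr_rel (free_gen K x).

Lemma sgen_bracket x y :
  sgen x * sgen y - sgen y * sgen x = \sum_i sbracket x y i *: sgen i.
Proof.
have piM a b : alg_pi schr_rel (a * b) = alg_pi schr_rel a * alg_pi schr_rel b :> U.
  exact: alg_piM.
rewrite /sgen -!piM -[LHS]alg_piB.
transitivity (alg_pi schr_rel (schr_tensor (sbracket x y)) : U).
  by apply/alg_piP/ideal_gen_in; exists x, y.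
rewrite /schr_tensor.
have piD : {morph alg_pi schr_rel : a b / a + b >-> (a + b : U)} by exact: alg_piD.
rewrite (big_morph _ piD (alg_pi0 _)); apply: eq_bigr => i _.
exact: alg_piZ.
Qed.

(** * Weights and category O *)

(* An element lam of the dual of h = <h, z>, in the basis dual to (h, z):
   lam.1 = lam(h) and lam.2 = lam(z). *)
Definition weight : Type := (K * K)%type.
HB.instance Definition _ := GRing.Zmodule.on weight.

Definition hvee : weight := (1, 0).

Definition weight_vec (M : lmodType U) (lam : weight) (v : M) : Prop :=
  forall a b : K,
    (a *: sgen Bh + b *: sgen Bz) *: v = (a * lam.1 + b * lam.2)%:A *: v.

(* M is the (internal) direct sum of its weight spaces. *)
Definition weight_module (M : lmodType U) : Prop :=
  (forall v : M, exists (s : seq weight) (w : weight -> M),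
     (forall mu, weight_vec mu (w mu)) /\ v = \sum_(mu <- s) w mu) /\
  (forall (s : seq weight) (w : weight -> M), uniq s ->
     (forall mu, weight_vec mu (w mu)) -> \sum_(mu <- s) w mu = 0 ->
     forall mu, mu \in s -> w mu = 0).

Definition in_support (M : lmodType U) (lam : weight) : Prop :=
  exists v : M, v != 0 /\ weight_vec lam v.

(* U(n_+), as a subalgebra of U. *)
Definition U_nplus : U -> Prop :=
  subalg_gen (fun u => u = sgen Be \/ u = sgen Bp).

Definition catO (M : lmodType U) : Prop :=
  [/\ fin_gen M, weight_module M &
    forall v : M, exists s : seq M, forall u, U_nplus u -> in_span s (u *: v)].

Definition is_coset (xi : weight -> Prop) : Prop :=
  exists lam, forall mu, xi mu <-> exists k : int, mu = lam + hvee *~ k.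

Definition catO_xi (xi : weight -> Prop) (M : lmodType U) : Prop :=
  catO M /\ forall mu, in_support M mu -> xi mu.

Definition catO_xi_le (xi : weight -> Prop) (lam : weight) (M : lmodType U) :
    Prop :=
  catO_xi xi M /\
  forall (i : int) (v : M), 1 <= i -> weight_vec (lam + hvee *~ i) v -> v = 0.

(** * Verma modules and simple highest weight modules *)

Definition verma_rel (lam : weight) (u : U^o) : Prop :=
  [\/ u = sgen Be, u = sgen Bp, u = sgen Bh - lam.1%:A | u = sgen Bz - lam.2%:A].

(* The tensor product of U with C_lam over U(b), presented as the quotient of U
   by the left ideal generated by the elements x - lam(x), x in b; the class of
   u corresponds to the tensor u (x) 1.  See verma_universal. *)
Definition Verma (lam : weight) : lmodType U := mod_quot (verma_rel lam).

Definition verma_gen (lam : weight) : Verma lam := mod_pi (verma_rel lam) 1.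

(* Universal property of extension of scalars: U-linear maps from Verma lam to
   M are the same as U(b)-linear maps from C_lam to M. *)
Lemma verma_universal (lam : weight) (M : lmodType U) (w : M) :
  sgen Be *: w = 0 -> sgen Bp *: w = 0 ->
  sgen Bh *: w = lam.1%:A *: w -> sgen Bz *: w = lam.2%:A *: w ->
  exists2 f : {linear Verma lam -> M}, f (verma_gen lam) = w &
    forall g : {linear Verma lam -> M}, g (verma_gen lam) = w -> f =1 g.
Proof.
move=> we wp wh wz.
pose act (u : U^o) := (u : U) *: w.
have actL : linear act by move=> a u v; rewrite /act scalerDl scalerA.
pose g := HB.pack_for {linear U^o -> M} act (GRing.isLinear.Build U U^o M _ act actL).
have gE u : g u = (u : U) *: w by [].
have [s [->|->|->|->]|f fE] := @mod_quot_lift _ _ (verma_rel lam) _ g.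
- by rewrite gE.
- by rewrite gE.
- by rewrite gE scalerBl wh subrr.
- by rewrite gE scalerBl wz subrr.
exists f => [|f' f'w q]; first by rewrite /verma_gen fE gE scale1r.
rewrite -[q]mod_piK; move: (repr q) => u.
by rewrite fE gE -f'w -linearZ /verma_gen -linearZ /= /GRing.scale /= mulr1.
Qed.

(* The quotient of Verma lam by the sum of all its proper submodules, i.e. by
   its unique maximal submodule. *)
Definition L (lam : weight) : lmodType U :=
  @mod_quot U (Verma lam)
    (fun x => exists N, [/\ submodule N, exists y, ~ N y & N x]).

End Schroedinger.

(** * The quiver Gamma *)

(* The four summands count the arrows i -> i-1, j-1 -> j (i, j nonzero) and
   i -> -i-2, -j-2 -> j (i, j >= 0). *)
Definition Gamma : quiver :=
  {| vertex := int;
     arrows := fun i j : int =>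
       (((i != 0) && (j == i - 1))%R + ((j != 0) && (i == j - 1))%R +
        ((0 <= i) && (j == - i - 2))%R + ((0 <= j) && (i == - j - 2))%R)%N |}.

Definition Gamma_le (n : int) : quiver :=
  @full_subquiver Gamma (fun m : int => m <= n).

(* Main.v *)
(* On a weight module with zero central charge z acts as 0, so p and q commute.
   On L(i), the simple sl_2-module of highest weight i, p and q act as 0, and the
   annihilator of its highest weight vector x0 is generated, as a left ideal, by
   e, p, q, h - i, z and, for i >= 0, f^(i+1).  An extension E of L(i) by L(j) is
   therefore determined by the vectors e m0, p m0, q m0 and f^(i+1) m0 of L(j),
   where m0 is a weight vector of E lifting x0.  They have weights i + 2, i + 1,
   i - 1 and - i - 2, and the weight spaces of L(j) have dimension at most 1.  The
   relations of the algebra, and the choice of m0, leave one free scalar if there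
   is an arrow i -> j and none otherwise.

   Conversely, the extensions along an arrow are found in explicit modules on
   polynomials: a Verma module of sl_2 for i -> - i - 2 (i >= 0), a dual Verma
   module for - j - 2 -> j (j >= 0), and the sum of the dual Verma modules of highest
   weights i and j, with p and q mapping the first to the second, for j = i + 1
   and j = i - 1. *)

(* Independence of the vectors f^k x0 is read off in modules of polynomials where e acts as d/dX:
   repeated differentiation brings any nonzero polynomial down to a nonzero constant. This
   identifies L(i) with the submodule generated by 1 in a dual Verma module: all polynomials if i <
   0, those of degree at most i otherwise. The exact annihilator of x0 follows.

   Ext^1 consists of Yoneda classes under Baer sum, so whole families of extensions are needed. For
   each pair, one module W contains L(j) and a vector w of weight i that the annihilator of x0 maps
   into L(j). The class with parameter c is the submodule of W (+) L(i) generated by (c w, x0) and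
   L(j), so that Baer sums and scalings of classes come from linear maps on W.

   The gap between 0 and -1 has two causes. For 0 -> -1, weights force f m0 = p m0 = 0, hence q m0 =
   [f, p] m0 = 0. For -1 -> 0, q m0 would have weight -2, which L(0) lacks, and then p m0 = [e, q]
   m0 = 0. *)
Require Import Defs.
From HB Require Import structures.
From mathcomp Require Import all_boot all_order all_algebra.
From mathcomp Require Import ring zify.
From mathcomp Require Import boolp reals complex finmap monalg.

Set Implicit Arguments.
Unset Strict Implicit.
Unset Printing Implicit Defensive.

Import Order.TTheory GRing.Theory Num.Theory.
Local Open Scope ring_scope.

(** * Modules over the enveloping algebra *)

Section FreeAlgebraModules.
Variables (K : comNzRingType) (I : choiceType).
Local Notation T := (free_alg K I).

Lemma free_alg_ind (P : T -> Prop) :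
  P 0 -> P 1 -> (forall c a b, P a -> P b -> P (c *: a + b)) ->
  (forall i a, P a -> P (free_gen K i * a)) -> forall a, P a.
Proof.
move=> P0 P1 PL PM a; rewrite [a]monalgE.
elim/big_ind: _ => //= [x y Px Py|m _]; first by rewrite -[x]scale1r; apply: PL.
have ->: << a@_m *g m >> = a@_m *: (<< m >> : T) + 0.
  rewrite addr0; apply/malgP => k; rewrite [RHS]mcoeffZ !mcoeffU.
  by rewrite mulr_natr.
apply: PL => //; case: m => s; elim: s => [|i s IH].
  have ->: FMonom [::] = mone :> {fmonom I} by apply/val_inj; rewrite /= fm1.
  exact: P1.
have ->: << FMonom (i :: s) >> = free_gen K i * (<< FMonom s >> : T).
  rewrite [RHS]malgM_def fgmulUU mulr1; congr << _ *g _>>.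
  by apply/val_inj; rewrite /= fmM fmU.
exact: PM.
Qed.

Variables (V : lmodType K) (op : I -> {linear V -> V}).

Definition mon_act (m : {fmonom I}) (v : V) : V := foldr (fun i => op i) v m.
Definition free_act (a : T) (v : V) : V := \sum_(m <- msupp a) a@_m *: mon_act m v.

Lemma free_actEw (d : {fset {fmonom I}}) a v : (msupp a `<=` d)%fset ->
  free_act a v = \sum_(m <- d) a@_m *: mon_act m v.
Proof.
move=> le; rewrite [LHS](big_fset_incl _ le) => //= x xd /mcoeff_outdom ->.
by rewrite scale0r.
Qed.

Lemma free_actP c a b v : free_act (c *: a + b) v = c *: free_act a v + free_act b v.
Proof.
pose d := (msupp a `|` msupp b)%fset.
have ab : (msupp (c *: a + b) `<=` d)%fset.
  apply: fsubset_trans (msuppD_le _ _) _; apply: fsetSU; exact: msuppZ_le.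
rewrite (free_actEw _ ab) (@free_actEw d a) ?fsubsetUl //.
rewrite (@free_actEw d b) ?fsubsetUr // scaler_sumr -big_split /=.
apply: eq_bigr => m _; rewrite scalerA -scalerDl.
congr (_ *: _); transitivity ((c *: a)@_m + b@_m); first exact: mcoeffD.
by congr (_ + _); apply: mcoeffZ.
Qed.

Lemma free_act0 v : free_act 0 v = 0.
Proof. by rewrite (@free_actEw fset0) ?msupp0 // big_seq_fset0. Qed.

Lemma free_actD a b v : free_act (a + b) v = free_act a v + free_act b v.
Proof. by rewrite -[a]scale1r free_actP !scale1r. Qed.

Lemma free_actZ c a v : free_act (c *: a) v = c *: free_act a v.
Proof. by rewrite -[c *: a]addr0 free_actP free_act0 addr0. Qed.

Lemma free_actB a b v : free_act (a - b) v = free_act a v - free_act b v.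
Proof. by rewrite -[- b]scaleN1r free_actD free_actZ scaleN1r. Qed.

Lemma free_actU (m : {fmonom I}) v : free_act << m >> v = mon_act m v.
Proof.
by rewrite (free_actEw _ msuppU_le) big_seq_fset1 mcoeffUU scale1r.
Qed.

Lemma free_act1 v : free_act 1 v = v.
Proof. by rewrite [LHS]free_actU /mon_act fm1. Qed.

Lemma free_act_gen i v : free_act (free_gen K i) v = op i v.
Proof. by rewrite [LHS]free_actU /mon_act fmU. Qed.

Lemma free_act_genM i a v : free_act (free_gen K i * a) v = op i (free_act a v).
Proof.
have e (m : {fmonom I}) :
    free_gen K i * (<< m >> : T) = (<< mmul (fmu i) m >> : T).
  by rewrite [LHS]malgM_def fgmulUU mulr1.
rewrite [a]monalgE; set s := \sum_(_ <- _) _.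
have -> : s = \sum_(m <- msupp a) a@_m *: (<< m >> : T).
  apply: eq_bigr => m _; apply/malgP => k; rewrite [RHS]mcoeffZ !mcoeffU.
  by rewrite mulr_natr.
rewrite mulr_sumr.
rewrite !(big_morph (free_act^~ v) (fun a b => free_actD a b v) (free_act0 v)).
rewrite linear_sum; apply: eq_bigr => m _.
rewrite -scalerAr; apply: etrans (free_actZ _ _ _) _.
rewrite e (free_actU (mmul (fmu i) m)) (free_actZ a@_m << m >>) (free_actU m).
by rewrite linearZ /= /mon_act fmM fmU.
Qed.

Lemma free_act_linear a : linear (free_act a).
Proof.
move=> c u v; rewrite /free_act scaler_sumr -big_split /=; apply: eq_bigr => m _.
have -> : mon_act m (c *: u + v) = c *: mon_act m u + mon_act m v.
  by case: m; rewrite /mon_act /=; elim=> //= i s ->; rewrite linearP.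
by rewrite scalerDr !scalerA mulrC.
Qed.

Lemma free_act_v0 a : free_act a 0 = 0.
Proof. by have := free_act_linear a (-1) 0 0; rewrite scaler0 addr0 scaleN1r addNr. Qed.

Lemma free_actM a b v : free_act (a * b) v = free_act a (free_act b v).
Proof.
elim/free_alg_ind: a => [||c x y hx hy|i x hx].
- by rewrite mul0r !free_act0.
- by rewrite mul1r free_act1.
- apply: etrans (_ : _ = free_act (c *: (x * b) + y * b) v) _.
    by rewrite mulrDl -scalerAl.
  apply: etrans (free_actP _ _ _ _) _; apply: etrans (esym (free_actP _ _ _ _)).
  by congr (_ *: _ + _).
- apply: etrans (_ : _ = free_act (free_gen K i * (x * b)) v) _.
    by rewrite mulrA.
  apply: etrans (free_act_genM _ _ _) _; apply: etrans (esym (free_act_genM _ _ _)).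
  by congr (op i _).
Qed.

End FreeAlgebraModules.

Section SchroedingerModule.
Variable K : fieldType.
Local Notation g := (sgen K).

Lemma U_ind (P : U K -> Prop) :
  P 0 -> P 1 -> (forall c a b, P a -> P b -> P (c *: a + b)) ->
  (forall x a, P a -> P (g x * a)) -> forall a, P a.
Proof.
move=> P0 P1 PL PM a; rewrite -[a]alg_piK; elim/free_alg_ind: (repr a).
- by rewrite alg_pi0.
- exact: P1.
- by move=> c x y hx hy; rewrite alg_piD alg_piZ; apply: PL.
- by move=> x y hy; rewrite alg_piM; apply: PM.
Qed.

Variables (V : lmodType K) (op : sbasis -> {linear V -> V}).
Hypothesis opP : forall x y v,
  op x (op y v) - op y (op x v) = \sum_i sbracket K x y i *: op i v.

(** The proof of the relations is an argument of this copy of V, so that the type alone determines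
    the action attached to it by the instances below. *)
Definition schr_module of (forall x y v,
  op x (op y v) - op y (op x v) = \sum_i sbracket K x y i *: op i v) : Type := V.
Local Notation M := (schr_module opP).
HB.instance Definition _ := GRing.Zmodule.on M.

(** The generators of the ideal kill every vector by [opP]. The vector stays general during the
    induction because a right multiple moves it before the ideal element acts. *)
Lemma free_act_rel a : ideal_gen (@schr_rel K) a -> forall v, free_act op a v = 0.
Proof.
elim=> [{}a [x [y ->]]||x y _ hx _ hy|x y _ hy|x y _ hy] v.
- rewrite (free_actB op (_ - _) (schr_tensor _)) (free_actB op (_ * _) (_ * _)).
  have e i j : free_act op (free_gen K i * free_gen K j) v = op i (op j v).
    by apply: etrans (free_act_genM _ _ _ _) _; rewrite (free_act_gen op j).
  apply: etrans (congr1 (fun w => w - _) (congr2 (fun a b => a - b) (e x y) (e y x))) _.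
  rewrite opP /schr_tensor.
  rewrite (big_morph (free_act op ^~ v) (fun a b => free_actD op a b v) (free_act0 op v)).
  apply/eqP; rewrite subr_eq0; apply/eqP; apply: eq_bigr => i _.
  by rewrite (free_actZ op (sbracket K x y i) (free_gen K i)) (free_act_gen op i).
- exact: free_act0.
- by rewrite free_actB hx hy subrr.
- by rewrite free_actM hy free_act_v0.
- by rewrite free_actM hy.
Qed.

Definition schr_scale (u : U K) (v : M) : M := free_act op (repr u) v.

Lemma schr_scale_pi a v : schr_scale (alg_pi (@schr_rel K) a) v = free_act op a v.
Proof.
apply/eqP; rewrite -subr_eq0 -free_actB; apply/eqP/free_act_rel.
exact: alg_repr.
Qed.

Fact schr_scaleA a b v : schr_scale a (schr_scale b v) = schr_scale (a * b) v.
Proof.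
transitivity (free_act op (repr a * repr b) v).
  by rewrite (free_actM op (repr a) (repr b)).
by rewrite -schr_scale_pi alg_piM !alg_piK.
Qed.
Fact schr_scale1 : left_id 1 schr_scale.
Proof. by move=> v; rewrite [LHS](schr_scale_pi 1) free_act1. Qed.
Fact schr_scaleDr : right_distributive schr_scale +%R.
Proof.
by move=> a u v; have := free_act_linear op (repr a) 1 u v; rewrite !scale1r.
Qed.
Fact schr_scaleDl v : {morph schr_scale^~ v : a b / a + b}.
Proof.
move=> a b; transitivity (free_act op (repr a + repr b) v).
  by rewrite -schr_scale_pi alg_piD !alg_piK.
exact: (free_actD op (repr a) (repr b)).
Qed.
HB.instance Definition _ := GRing.Zmodule_isLmodule.Build (U K) M
  schr_scaleA schr_scale1 schr_scaleDr schr_scaleDl.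

Lemma schr_moduleE x (v : M) : g x *: v = op x v.
Proof. by rewrite [LHS]schr_scale_pi free_act_gen. Qed.

Lemma schr_moduleZ (c : K) (v : M) : c%:A *: v = (c *: (v : V)) :> V.
Proof.
have e : c%:A = alg_pi (@schr_rel K) (c *: 1) :> U K by rewrite [RHS]alg_piZ.
by rewrite e [LHS]schr_scale_pi (free_actZ op c 1) (free_act1 op).
Qed.

End SchroedingerModule.

Section Submodule.
Variables (K : fieldType) (A : algType K) (V : lmodType A) (P : V -> Prop).
Definition sub_pred of submodule P : {pred V} := fun v => `[< P v >].
Hypothesis hP : submodule P.
Fact sub_pred_closed : GRing.submod_closed (sub_pred hP).
Proof.
case: hP => P0 PL; split; first exact/asboolP.
by move=> a u v /asboolP hu /asboolP hv; apply/asboolP/PL.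
Qed.
HB.instance Definition _ := GRing.isSubmodClosed.Build A V (sub_pred hP) sub_pred_closed.
Definition sub_mod : Type := {v : V | sub_pred hP v}.
HB.instance Definition _ := [isSub of sub_mod for sval].
HB.instance Definition _ := [Choice of sub_mod by <:].
HB.instance Definition _ := [SubChoice_isSubLmodule of sub_mod by <:].
End Submodule.

Notation "c *| v" := (c%:A *: v) (at level 40, left associativity).

Lemma sum_pred1_seq (I : eqType) (V : nmodType) (s : seq I) (i : I) (F : I -> V) :
  uniq s -> i \in s -> \sum_(j <- s | j == i) F j = F i.
Proof.
by move=> us hi; rewrite -big_filter filter_pred1_uniq // big_seq1.
Qed.

Section Brackets.
Variables (K : fieldType) (V : lmodType K) (F : sbasis -> V).

Definition half_bracket (x y : sbasis) : V :=
  match x, y with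
  | Bh, Be => F Be *+ 2
  | Be, Bf => F Bh
  | Bh, Bf => - (F Bf *+ 2)
  | Be, Bq => F Bp
  | Bh, Bp => F Bp
  | Bf, Bp => F Bq
  | Bh, Bq => - F Bq
  | Bp, Bq => F Bz
  | _, _ => 0
  end.

(** Extending [F] linearly turns the bracket in coordinates into the same table with values in V.
    Every verification of relations thereby becomes a finite case analysis. *)
Lemma sum_sbracket x y :
  \sum_i sbracket K x y i *: F i = half_bracket x y - half_bracket y x.
Proof.
pose S (v : {ffun sbasis -> K}) := \sum_i v i *: F i.
have SB u v : S (u - v) = S u - S v.
  by rewrite /S -sumrB; apply: eq_bigr => i _; rewrite !ffunE scalerBl.
have S0 : S 0 = 0 by rewrite -(subrr 0) SB subrr.
have SN u : S (- u) = - S u by rewrite -sub0r SB S0 sub0r.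
have SD u v : S (u + v) = S u + S v by rewrite -[v]opprK SB SN !opprK.
have Sb z : S (sbas K z) = F z.
  rewrite /S (bigD1 z) //= !ffunE eqxx scale1r big1 ?addr0 // => i /negPf iz.
  by rewrite !ffunE iz scale0r.
have Sh z t : S (sbracket_half K z t) = half_bracket z t.
  by case: z t => -[]; rewrite /= ?S0 ?SN ?mulr2n ?SD ?Sb.
by rewrite -!Sh -SB.
Qed.
End Brackets.

(** * Weight modules *)

(* The universal property of U(s).  It is used with an abstract algebra A in
   place of U, since unification would unfold the quotient construction of U. *)
Record enveloping (K : fieldType) (A : algType K) (g : sbasis -> A) : Prop := {
  env_bracket : forall x y, g x * g y - g y * g x = \sum_i sbracket K x y i *: g i;
  env_ind : forall P : A -> Prop, P 0 -> P 1 ->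
    (forall c a b, P a -> P b -> P (c *: a + b)) ->
    (forall x a, P a -> P (g x * a)) -> forall a, P a;
  env_rep : forall (V : lmodType K) (op : sbasis -> {linear V -> V}),
    (forall x y v, op x (op y v) - op y (op x v) =
       \sum_i sbracket K x y i *: op i v) ->
    exists (M : lmodType A) (phi : V -> M), [/\ bijective phi,
      forall c u v, phi (c *: u + v) = c *| phi u + phi v &
      forall x v, phi (op x v) = g x *: phi v] }.

Lemma U_enveloping (K : fieldType) : enveloping (@sgen K).
Proof.
split=> [||V op opP]; first exact: sgen_bracket.
  exact: U_ind.
exists (schr_module opP), id; split=> [|c u v|x v]; first by exists id.
  by rewrite schr_moduleZ.
by rewrite schr_moduleE.
Qed.

Section ModuleBasics.
Variables (K : fieldType) (A : algType K) (g : sbasis -> A).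
Hypothesis gE : enveloping g.
Implicit Types (M : lmodType A).

(* For A = U and g = sgen, the definitions of weight_vec, weight_module,
   in_support, U_nplus and catO. *)
Definition wvec M (lam : weight K) (v : M) : Prop :=
  forall a b : K,
    (a *: g Bh + b *: g Bz) *: v = (a * lam.1 + b * lam.2)%:A *: v.

Definition wmodule M : Prop :=
  (forall v : M, exists (s : seq (weight K)) (w : weight K -> M),
     (forall mu, wvec mu (w mu)) /\ v = \sum_(mu <- s) w mu) /\
  (forall (s : seq (weight K)) (w : weight K -> M), uniq s ->
     (forall mu, wvec mu (w mu)) -> \sum_(mu <- s) w mu = 0 ->
     forall mu, mu \in s -> w mu = 0).

Definition wsupport M (lam : weight K) : Prop :=
  exists v : M, v != 0 /\ wvec lam v.

Definition nplus_alg : A -> Prop :=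
  subalg_gen (fun u => u = g Be \/ u = g Bp).

Definition catOg M : Prop :=
  [/\ fin_gen M, wmodule M &
    forall v : M, exists s : seq M, forall u, nplus_alg u -> in_span s (u *: v)].

Lemma ksc_scale M (u : A) (c : K) (v : M) : (c *: u) *: v = c *| (u *: v).
Proof. by rewrite scalerA mulr_algl. Qed.

Lemma ksc_comm M (u : A) (c : K) (v : M) : u *: (c *| v) = c *| (u *: v).
Proof. by rewrite !scalerA mulr_algr mulr_algl. Qed.

Lemma kscA M (a b : K) (v : M) : a *| (b *| v) = (a * b) *| v.
Proof. by rewrite scalerA mulr_algl scalerA. Qed.

Lemma ksc1 M (v : M) : 1 *| v = v. Proof. by rewrite !scale1r. Qed.
Lemma ksc0 M (v : M) : 0 *| v = 0. Proof. by rewrite !scale0r. Qed.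
Lemma kscDl M (a b : K) (v : M) : (a + b) *| v = a *| v + b *| v.
Proof. by rewrite !scalerDl. Qed.
Lemma kscNl M (a : K) (v : M) : (- a) *| v = - (a *| v).
Proof. by rewrite !scaleNr. Qed.
Lemma kscBl M (a b : K) (v : M) : (a - b) *| v = a *| v - b *| v.
Proof. by rewrite kscDl kscNl. Qed.
Lemma ksc_eq0 M (a : K) (v : M) : a *| v = 0 -> a != 0 -> v = 0.
Proof. by move=> h a0; rewrite -[v]ksc1 -(mulVf a0) -kscA h scaler0. Qed.

(** The form in which all later computations use the commutation relations: x moves past y at the
    cost of [x, y]. *)
Lemma gen_swap M x y (v : M) : g x *: (g y *: v) =
  g y *: (g x *: v) + (half_bracket g x y *: v - half_bracket g y x *: v).
Proof.
by rewrite -scalerBl -sum_sbracket -(env_bracket gE) scalerBl !scalerA addrC subrK.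
Qed.

Lemma U_closed M (P : M -> Prop) : P 0 ->
  (forall c u v, P u -> P v -> P (c *| u + v)) ->
  (forall x v, P v -> P (g x *: v)) -> forall (u : A) v, P v -> P (u *: v).
Proof.
move=> P0 PL Pg u v Pv; elim/(env_ind gE): u => [||c a b ha hb|x a ha].
- by rewrite scale0r.
- by rewrite scale1r.
- by rewrite scalerDl ksc_scale; apply: PL.
- by rewrite -scalerA; apply: Pg.
Qed.

Lemma weight_vecP M (mu : weight K) (v : M) : wvec mu v <->
  g Bh *: v = mu.1 *| v /\ g Bz *: v = mu.2 *| v.
Proof.
split=> [h|[h1 h2] a b]; last first.
  by rewrite [LHS]scalerDl (ksc_scale (g Bh)) (ksc_scale (g Bz)) h1 h2 !kscA kscDl.
have e a b : a *| (g Bh *: v) + b *| (g Bz *: v) = (a * mu.1 + b * mu.2) *| v.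
  by rewrite -(ksc_scale (g Bh)) -(ksc_scale (g Bz)) -scalerDl h.
have := e 0 1; have := e 1 0.
by rewrite !(mul1r, mul0r, ksc1, ksc0, addr0, add0r).
Qed.

Lemma weight_vec0 M mu : wvec mu (0 : M).
Proof. by apply/weight_vecP; rewrite !scaler0. Qed.

Lemma weight_vecL M mu c (u v : M) :
  wvec mu u -> wvec mu v -> wvec mu (c *| u + v).
Proof.
move=> /weight_vecP[u1 u2] /weight_vecP[v1 v2]; apply/weight_vecP.
by rewrite !scalerDr !(ksc_comm (g _)) u1 u2 v1 v2 !kscA !(mulrC c).
Qed.

Lemma weight_vecZ M mu c (u : M) : wvec mu u -> wvec mu (c *| u).
Proof. by move=> hu; rewrite -[_ *: _]addr0; apply: weight_vecL => //; apply: weight_vec0. Qed.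

Lemma weight_vecD M mu (u v : M) :
  wvec mu u -> wvec mu v -> wvec mu (u + v).
Proof. by move=> hu hv; rewrite -[u]ksc1; apply: weight_vecL. Qed.

Lemma weight_vecB M mu (u v : M) :
  wvec mu u -> wvec mu v -> wvec mu (u - v).
Proof.
by move=> hu hv; apply: weight_vecD => //; rewrite -[v]ksc1 -kscNl; apply: weight_vecZ.
Qed.

Lemma weight_vec_lin M (N : lmodType A) (f : {linear M -> N}) mu v :
  wvec mu v -> wvec mu (f v).
Proof.
by move=> /weight_vecP[h1 h2]; apply/weight_vecP; rewrite -!linearZ_LR h1 h2.
Qed.

Lemma weight_vec_inj M (N : lmodType A) (f : {linear M -> N}) mu v : injective f ->
  wvec mu (f v) -> wvec mu v.
Proof.
by move=> fI /weight_vecP[h1 h2]; apply/weight_vecP; split; apply: fI;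
  rewrite !linearZ_LR.
Qed.

Definition gen_weight (x : sbasis) : int :=
  match x with Be => 2 | Bp => 1 | Bf => - 2 | Bq => - 1 | _ => 0 end.

Lemma hveeE (n : int) : hvee K *~ n = (n%:~R, 0) :> weight K.
Proof.
have hn (m : nat) : hvee K *+ m = (m%:R, 0) :> weight K.
  by elim: m => // m IH; rewrite mulrSr IH mulrSr; congr pair; rewrite /= addr0.
case: n => m; first by rewrite -pmulrn hn.
by rewrite NegzE !mulrNz -!pmulrn hn; congr pair; rewrite oppr0.
Qed.

Lemma weight_gen M mu x (v : M) :
  wvec mu v -> wvec (mu + hvee K *~ gen_weight x) (g x *: v).
Proof.
move=> /weight_vecP[h1 h2]; apply/weight_vecP; rewrite hveeE /= addr0 kscDl.
rewrite !(gen_swap _ x) h1 h2 !(ksc_comm (g _)).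
by case: x; rewrite /= ?subr0 ?sub0r ?scaleNr ?scaler0 ?scale0r ?oppr0 ?addr0
  ?opprK ?(ksc0, ksc1) ?addr0 //; split=> //; congr (_ + _);
  rewrite ?mulr2n ?scalerDl ?mulrNz ?kscNl -?pmulrn ?mulr2n ?kscDl ?ksc1.
Qed.

(** Induction on the number of weights. Two distinct weights differ on h or on z; subtracting from
    that element its eigenvalue at nu kills the nu-component and multiplies the mu-component by a
    nonzero scalar. *)
Lemma weight_split M (N : M -> Prop) (s : seq (weight K)) (w : weight K -> M) :
  submodule N -> uniq s -> (forall mu, wvec mu (w mu)) ->
  N (\sum_(mu <- s) w mu) -> forall mu, mu \in s -> N (w mu).
Proof.
move=> [N0 NL].
have NB u v : N u -> N v -> N (u - v).
  by move=> hu hv; rewrite addrC -scaleN1r; apply: NL.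
elim: s w => [|nu s IH] w //= /andP[nus us] hw; rewrite big_cons => hN.
have step (c : weight K -> K) (a : A) :
    (forall mu v, wvec mu v -> a *: v = c mu *| v :> M) ->
    forall mu, mu \in s -> N ((c mu - c nu) *| w mu).
  move=> ca; apply: (IH (fun mu => (c mu - c nu) *| w mu)) => //.
    by move=> mu; apply: weight_vecZ.
  have := NL (a - (c nu)%:A) _ _ hN N0; rewrite addr0; congr N.
  rewrite scalerDr [X in X + _]scalerBl (ca nu) // subrr add0r scaler_sumr.
  by apply: eq_bigr => mu _; rewrite scalerBl (ca mu) // kscBl.
have hs mu : mu \in s -> N (w mu).
  move=> mus.
  have hh : mu.1 != nu.1 \/ mu.2 != nu.2.
    apply/orP; rewrite -negb_and; apply: contraNN nus => /andP[/eqP e1 /eqP e2].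
    suff <- : mu = nu by [].
    by case: mu nu e1 e2 {hN step us mus} => [? ?] [? ?] /= -> ->.
  have fin c : N (c *| w mu) -> c != 0 -> N (w mu).
    move=> hc c0; rewrite -[w mu]ksc1 -(mulVf c0) -kscA -[X in N X]addr0.
    exact: NL.
  case: hh => hc.
    apply: (fin (mu.1 - nu.1)); last by rewrite subr_eq0.
    by apply: (step fst (g Bh)) => // m v /weight_vecP[].
  apply: (fin (mu.2 - nu.2)); last by rewrite subr_eq0.
  by apply: (step snd (g Bz)) => // m v /weight_vecP[].
have hS : N (\sum_(mu <- s) w mu).
  rewrite big_seq; elim/big_ind: _ => // u v hu hv.
  by rewrite -[u]scale1r; apply: NL.
move=> mu; rewrite inE => /orP[/eqP->|]; last exact: hs.
by rewrite -(addrK (\sum_(j <- s) w j) (w nu)); apply: NB.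
Qed.

Lemma submodule0 M : submodule (fun v : M => v = 0).
Proof. by split=> // a u v -> ->; rewrite scaler0 addr0. Qed.

(** A weight may occur several times in the list, so closure under sums is concatenation;
    [wsum_norm] collects equal weights afterwards. *)
Definition wspan M (v : M) := exists s : seq (weight K * M),
  (forall p, p \in s -> wvec p.1 p.2) /\ v = \sum_(p <- s) p.2.

Lemma wspan_weight M mu (v : M) : wvec mu v -> wspan v.
Proof.
move=> hv; exists [:: (mu, v)]; rewrite big_seq1; split=> // p.
by rewrite inE => /eqP->.
Qed.

Lemma wspanL M c (u v : M) : wspan u -> wspan v -> wspan (c *| u + v).
Proof.
move=> [s [hs ->]] [t [ht ->]].
exists ([seq (p.1, c *| p.2) | p <- s] ++ t); split.
  move=> p; rewrite mem_cat => /orP[/mapP[q qs ->]|]; last exact: ht.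
  exact/weight_vecZ/hs.
by rewrite big_cat big_map /= scaler_sumr.
Qed.

Lemma wspan_gen M x (v : M) : wspan v -> wspan (g x *: v).
Proof.
move=> [s [hs ->]].
exists [seq (p.1 + hvee K *~ gen_weight x : weight K, g x *: p.2) | p <- s]; split.
  move=> p /mapP[q qs ->]; exact/weight_gen/hs.
by rewrite big_map /= scaler_sumr.
Qed.

Lemma wspanU M (u : A) (v : M) : wspan v -> wspan (u *: v).
Proof.
apply: U_closed; last by move=> x w; exact: wspan_gen.
- by apply: (wspan_weight (mu := 0)); exact: weight_vec0.
- by move=> c a b; exact: wspanL.
Qed.

Lemma wsum_norm M (s : seq (weight K * M)) :
  (forall p, p \in s -> wvec p.1 p.2) ->
  exists (t : seq (weight K)) (w : weight K -> M), [/\ uniq t,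
    {subset t <= [seq p.1 | p <- s]}, forall mu, wvec mu (w mu) &
    \sum_(p <- s) p.2 = \sum_(mu <- t) w mu].
Proof.
move=> hs; exists (undup [seq p.1 | p <- s]), (fun mu => \sum_(p <- s | p.1 == mu) p.2).
split; first exact: undup_uniq.
- by move=> mu; rewrite mem_undup.
- move=> mu; rewrite big_seq_cond; elim/big_ind: _ => [|u v' hu hv|p].
  + exact: weight_vec0.
  + exact: weight_vecD.
  + by move=> /andP[/hs + /eqP <-].
rewrite (exchange_big_dep xpredT) //= [LHS]big_seq [RHS]big_seq.
apply: eq_bigr => p ps.
rewrite (eq_bigl (fun mu => mu == p.1)); last by move=> mu; rewrite eq_sym.
by rewrite sum_pred1_seq ?undup_uniq // mem_undup map_f.
Qed.

Lemma wspan_norm M (v : M) : wspan v ->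
  exists (s : seq (weight K)) (w : weight K -> M), [/\ uniq s,
     forall mu, wvec mu (w mu) & v = \sum_(mu <- s) w mu].
Proof.
by move=> [s [/wsum_norm[t [w [ut _ hw ->]]] ->]]; exists t, w.
Qed.

(** The weights in [s] may repeat; only mu has to be isolated. *)
Lemma weight_lead M (N : M -> Prop) mu (v : M) (s : seq (weight K * M)) :
  submodule N -> wvec mu v ->
  (forall p, p \in s -> wvec p.1 p.2 /\ p.1 != mu) ->
  N (v + \sum_(p <- s) p.2) -> N v.
Proof.
move=> hN hv hs.
have [|t [w [ut ts hw ->]]] := @wsum_norm _ s; first by move=> p /hs[].
have mut : mu \notin t.
  by apply/negP => /ts /mapP[p /hs[_ /eqP h] /esym].
pose w' nu := if nu == mu then v else w nu.
have hw' nu : wvec nu (w' nu) by rewrite /w'; case: eqP => [->|].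
have e : \sum_(nu <- mu :: t) w' nu = v + \sum_(nu <- t) w nu.
  rewrite big_cons /w' eqxx; congr (_ + _); apply: eq_big_seq => nu nut.
  by case: eqP nut => // ->; rewrite (negPf mut).
move=> h; have := weight_split (s := mu :: t) hN _ hw'.
by rewrite e /= mut ut => /(_ isT h mu (mem_head _ _)); rewrite /w' eqxx.
Qed.

(** The independence of the weight spaces is [weight_split] for the zero submodule. *)
Lemma weight_moduleP M : wmodule M <-> forall v : M, wspan v.
Proof.
split=> [[h _] v|h].
  have [s [w [hw ->]]] := h v.
  exists [seq (mu, w mu) | mu <- s]; rewrite big_map; split=> //.
  by move=> p /mapP[mu _ ->]; exact: hw.
split=> [v|s w us hw h0]; first by have [s [w [? ? ?]]] := wspan_norm (h v); exists s, w.
exact: (weight_split (@submodule0 M) us hw h0).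
Qed.

Lemma weight_indep M (N : M -> Prop) mu (v : M) s w : submodule N ->
  (forall nu, wvec nu (w nu)) -> wvec mu v -> uniq s ->
  N (v - \sum_(nu <- s) w nu) -> N (v - (if mu \in s then w mu else 0)).
Proof.
move=> hN hw hv us h.
pose w' nu := (if nu == mu then v else 0) - (if nu \in s then w nu else 0).
have hw' nu : wvec nu (w' nu).
  rewrite /w'; case: eqP => [->|_]; case: ifP => _; apply: weight_vecB => //;
  exact: weight_vec0.
have := weight_split (s := undup (mu :: s)) hN (undup_uniq _) hw'.
rewrite sumrB -!big_mkcond /=.
have e1 : \sum_(i <- undup (mu :: s) | i == mu) v = v.
  by rewrite sum_pred1_seq ?undup_uniq // mem_undup mem_head.
have e2 : \sum_(i <- undup (mu :: s) | i \in s) w i = \sum_(i <- s) w i.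
  rewrite /=; case: ifP => ms; rewrite ?big_cons ?ms undup_id //;
  by rewrite -big_filter (eq_in_filter (a2 := predT)) ?filter_predT // => i ->.
rewrite /= in e1 e2; rewrite e1 e2 => /(_ h mu).
rewrite -/(undup (mu :: s)) mem_undup mem_head => /(_ isT).
by rewrite /w' eqxx.
Qed.

(** Any preimage of x is a sum of weight vectors, and its component of weight mu already maps to x,
    by independence in the target. *)
Lemma weight_lift M (N : lmodType A) (f : {linear M -> N}) mu x : wmodule M ->
  (forall y, exists m, f m = y) -> wvec mu x ->
  exists2 m, f m = x & wvec mu m.
Proof.
move=> /weight_moduleP hM fS hx; have [m fm] := fS x.
have [s [w [us hw mE]]] := wspan_norm (hM m).
exists (if mu \in s then w mu else 0); last by case: ifP => _ //; exact: weight_vec0.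
have hfw nu : wvec nu (f (w nu)) by exact: weight_vec_lin.
have := weight_indep (@submodule0 N) hfw hx us.
rewrite -linear_sum -mE fm subrr => /(_ erefl)/eqP.
by rewrite subr_eq0 => /eqP ->; case: ifP; rewrite ?linear0.
Qed.

End ModuleBasics.

(** * Local finiteness and category O *)

Section LocallyFinite.
Variables (K : numFieldType) (A : algType K) (g : sbasis -> A).
Hypothesis gE : enveloping g.
Implicit Types (M : lmodType A).

Lemma hvee_inj : injective (fun n : int => hvee K *~ n).
Proof.
by move=> m n /=; rewrite (hveeE K m) (hveeE K n) => -[] /eqP; rewrite eqr_int => /eqP.
Qed.

Lemma in_spanL M (s : seq M) c u v :
  in_span s u -> in_span s v -> in_span s (c *| u + v).
Proof.
move=> [a ->] [b ->]; exists (fun i => c * a i + b i).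
rewrite scaler_sumr -big_split /=; apply: eq_bigr => i _.
by rewrite kscA kscDl.
Qed.

Lemma in_span0 M (s : seq M) : in_span s (0 : M).
Proof. by exists (fun=> 0); rewrite big1 // => i _; rewrite ksc0. Qed.

Lemma in_span_mem M (s : seq M) v : v \in s -> in_span s v.
Proof.
move=> vs; have h : (index v s < size s)%N by rewrite index_mem.
exists (fun i => (i == Ordinal h)%:R).
rewrite (bigD1 (Ordinal h)) //= eqxx ksc1 nth_index // big1 ?addr0 //.
by move=> i /negPf ->; rewrite ksc0.
Qed.

Lemma in_span_ind M (s : seq M) (P : M -> Prop) : P 0 ->
  (forall c u v, P u -> P v -> P (c *| u + v)) ->
  (forall v, v \in s -> P v) -> forall v, in_span s v -> P v.
Proof.
move=> P0 PL Ps _ [c ->]; elim/big_ind: _ => [//|u v hu hv|i _].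
  by rewrite -[u]ksc1; apply: PL.
by rewrite -[_ *: _]addr0; apply: PL => //; apply/Ps/mem_nth.
Qed.

Lemma in_span_sub M (s t : seq M) v : {subset s <= t} -> in_span s v -> in_span t v.
Proof.
move=> st; apply: in_span_ind; first exact: in_span0.
  by move=> c x y; exact: in_spanL.
by move=> x /st; exact: in_span_mem.
Qed.

Lemma in_spanD M (s : seq M) u v : in_span s u -> in_span s v -> in_span s (u + v).
Proof. by move=> hu hv; rewrite -[u]ksc1; apply: in_spanL. Qed.

Definition nplus x := x = Be \/ x = Bp.

(** Asking for a finite list whose span is stable under e and p, instead of one spanning the orbit
    of U(n_+), gives a condition that passes to sums and to images under generators. *)
Definition loc_fin M (v : M) := exists s : seq M, in_span s v /\
  forall x u, nplus x -> u \in s -> in_span s (g x *: u).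

Lemma span_stable M (s t : seq M) (a : A) :
  (forall u, u \in s -> in_span t (a *: u)) ->
  forall u, in_span s u -> in_span t (a *: u).
Proof.
move=> h; apply: in_span_ind => //; first by rewrite scaler0; exact: in_span0.
by move=> c x y hx hy; rewrite scalerDr ksc_comm; apply: in_spanL.
Qed.

Lemma loc_finP M (v : M) : loc_fin v ->
  exists s : seq M, forall u, nplus_alg g u -> in_span s (u *: v).
Proof.
move=> [s [sv hs]]; exists s => u hu; elim: hu v sv => {u}.
- move=> u hu v sv; apply: (@span_stable _ s) => // w ws.
  by case: hu => ->; apply: hs; [left| |right|].
- by move=> v; rewrite scale1r.
- by move=> c a b _ ha _ hb v sv; rewrite scalerDl ksc_scale; apply: in_spanL; auto.
- by move=> a b _ ha _ hb v sv; rewrite -scalerA; auto.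
Qed.

Lemma loc_finL M c (u v : M) : loc_fin u -> loc_fin v -> loc_fin (c *| u + v).
Proof.
move=> [s [su hs]] [t [tv ht]]; exists (s ++ t).
have sl : {subset s <= s ++ t} by move=> x; rewrite mem_cat => ->.
have sr : {subset t <= s ++ t} by move=> x; rewrite mem_cat orbC => ->.
split; first by apply: in_spanL; [exact: in_span_sub sl su|exact: in_span_sub sr tv].
move=> x w hx; rewrite mem_cat => /orP[ws|wt].
  exact: in_span_sub sl (hs x w hx ws).
exact: in_span_sub sr (ht x w hx wt).
Qed.

Lemma loc_fin0 M : loc_fin (0 : M).
Proof. by exists [::]; split=> //; exact: in_span0. Qed.

Lemma loc_fin_step M (v : M) :
  loc_fin (g Be *: v) -> loc_fin (g Bp *: v) -> loc_fin v.
Proof.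
move=> [s [su hs]] [t [tv ht]]; exists (v :: s ++ t).
have sl : {subset s <= v :: s ++ t} by move=> x; rewrite inE mem_cat => ->; rewrite orbT.
have sr : {subset t <= v :: s ++ t} by move=> x; rewrite inE mem_cat => ->; rewrite !orbT.
split; first by apply: in_span_mem; rewrite mem_head.
move=> x w hx; rewrite inE mem_cat => /or3P[/eqP->|ws|wt].
- case: hx => ->; [exact: in_span_sub sl su|exact: in_span_sub sr tv].
- exact: in_span_sub sl (hs x w hx ws).
- exact: in_span_sub sr (ht x w hx wt).
Qed.

Lemma in_span_bracket M (s : seq M) x y v :
  (forall z, in_span s (g z *: v)) ->
  in_span s (half_bracket g x y *: v - half_bracket g y x *: v).
Proof.
move=> h; rewrite -scalerBl -sum_sbracket.
rewrite (big_morph (fun a => a *: v) (scalerDl v) (scale0r v)).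
elim/big_ind: _ => [|a b|i _]; first exact: in_span0.
  exact: in_spanD.
by rewrite ksc_scale -[_ *: _]addr0; apply: in_spanL => //; exact: in_span0.
Qed.

(** If the span of s is stable under e and p, so is the span of s together with all z u, for z a
    basis vector and u in s, because x z u = z x u + [x, z] u. *)
Lemma loc_fin_gen M y (v : M) : loc_fin v -> loc_fin (g y *: v).
Proof.
move=> [s [sv hs]]; pose t := s ++ [seq g z *: u | z <- [:: Be; Bh; Bf; Bp; Bq; Bz], u <- s].
have gt z u : u \in s -> in_span t (g z *: u).
  move=> us; apply: in_span_mem; rewrite mem_cat; apply/orP; right.
  by apply/allpairsP; exists (z, u); split=> //; rewrite !inE; case: z; rewrite eqxx ?orbT.
exists t; split; first by apply: span_stable sv => u; exact: gt.
move=> x u hx; rewrite mem_cat => /orP[us|/allpairsP[[z w] /= [_ ws ->]]].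
  exact: gt.
rewrite (gen_swap gE); apply: in_spanD; last first.
  by apply: in_span_bracket => z'; exact: gt.
by apply: (@span_stable _ s) => [w'|]; [exact: gt|exact: hs].
Qed.

Lemma loc_finU M (u : A) (v : M) : loc_fin v -> loc_fin (u *: v).
Proof.
apply: (U_closed gE); first exact: loc_fin0.
  by move=> c a b; exact: loc_finL.
by move=> x w; exact: loc_fin_gen.
Qed.

Lemma submod_gen_ind M (S : M -> Prop) (P : M -> Prop) :
  P 0 -> (forall c u v, P u -> P v -> P (c *| u + v)) ->
  (forall (u : A) v, P v -> P (u *: v)) -> (forall v, S v -> P v) ->
  forall v, submod_gen S v -> P v.
Proof.
move=> P0 PL PU PS v; elim=> // a x y _ hx _ hy.
by rewrite -[a *: x]ksc1; apply: PL => //; exact: PU.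
Qed.

Lemma catO_gen M (s : seq M) : (forall v, submod_gen (fun y => y \in s) v) ->
  (forall v, v \in s -> (exists mu, wvec g mu v) /\ loc_fin v) -> catOg g M.
Proof.
move=> sM hs; split; first by exists s.
  apply: (weight_moduleP g M).2 => v; have := sM v; move: v; apply: submod_gen_ind.
  - exact: (wspan_weight (weight_vec0 g _ 0)).
  - by move=> c u v; exact: wspanL.
  - by move=> u v; exact: (wspanU gE).
  - by move=> v /hs[[mu hv] _]; exact: wspan_weight hv.
move=> v; apply: loc_finP; have := sM v; move: v; apply: submod_gen_ind.
- exact: loc_fin0.
- by move=> c u v; exact: loc_finL.
- by move=> u v; exact: loc_finU.
- by move=> v /hs[].
Qed.

Lemma gen_expS M x k (v : M) : g x ^+ k.+1 *: v = g x *: (g x ^+ k *: v).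
Proof. by rewrite exprS scalerA. Qed.

Lemma weight_exp M mu x k (v : M) : wvec g mu v ->
  wvec g (mu + hvee K *~ (gen_weight x *+ k)) (g x ^+ k *: v).
Proof.
move=> hv; elim: k => [|k IH]; first by rewrite scale1r addr0.
rewrite gen_expS mulrSr mulrzDr addrA; exact: (weight_gen gE).
Qed.

(** Otherwise all x^k v are nonzero, of pairwise distinct weights. Finiteness puts n + 1 of them in
    the span of n vectors, and a kernel row of the coefficient matrix is a nontrivial relation,
    against the independence of weight spaces. *)
Lemma exp_vanish M mu x (v : M) : nplus x -> v != 0 -> wvec g mu v ->
  (exists s : seq M, forall u, nplus_alg g u -> in_span s (u *: v)) ->
  exists k, g x ^+ k *: v != 0 /\ g x ^+ k.+1 *: v = 0.
Proof.
move=> nx v0 hv [s hs].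
suff hk : exists k, g x ^+ k *: v == 0.
  case: (ex_minnP hk) => -[|m] h0 hm; first by rewrite scale1r (negPf v0) in h0.
  exists m; split; last exact/eqP.
  by apply/negP => /hm; rewrite ltnn.
apply: contrapT => hN; have {}hN k : g x ^+ k *: v != 0.
  by apply/negP => h; apply: hN; exists k.
have hsp k : in_span s (g x ^+ k *: v).
  apply: hs; elim: k => [|k IH]; first exact: subalg_gen1.
  rewrite exprS; apply: subalg_genM => //; apply: subalg_gen_in.
  by case: nx => ->; [left|right].
have [c hc] := choice hsp.
pose n := size s.
pose C : 'M[K]_(n.+1, n) := \matrix_(k, i) c k i.
have : kermx C != 0.
  rewrite -mxrank_eq0 mxrank_ker subn_eq0 -ltnNge.
  by apply: leq_ltn_trans (rank_leq_col C) _.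
move=> /rowV0Pn[a ak a0].
have aC : a *m C = 0 by apply/sub_kermxP.
have hsum : \sum_(k < n.+1) a 0 k *| (g x ^+ k *: v) = 0.
  under eq_bigr => k _ do rewrite hc scaler_sumr.
  rewrite exchange_big big1 //= => i _.
  under eq_bigr => k _ do rewrite kscA.
  rewrite -scaler_suml -scaler_suml.
  have := congr1 (fun m : 'M_(_, _) => m 0 i) aC; rewrite !mxE => e.
  by rewrite (eq_bigr (fun k => a 0 k * C k i)) ?e ?ksc0 // => k _; rewrite mxE.
pose wt (k : nat) : weight K := mu + hvee K *~ (gen_weight x *+ k).
have wtI : injective wt.
  move=> k l /addrI /hvee_inj.
  by case: nx => ->; rewrite /= -[_ *+ k]mulr_natr -[_ *+ l]mulr_natr !natz; lia.
pose S := [seq wt (k : 'I__) | k <- enum 'I_n.+1].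
pose w nu := \sum_(k < n.+1 | wt k == nu) a 0 k *| (g x ^+ k *: v).
have hw nu : wvec g nu (w nu).
  rewrite /w; elim/big_ind: _ => [|u1 u2|k /eqP <-]; first exact: weight_vec0.
    exact: weight_vecD.
  by apply: weight_vecZ; exact: weight_exp.
have wk (k : 'I_n.+1) : w (wt k) = a 0 k *| (g x ^+ k *: v).
  rewrite /w (big_pred1 k) // => l /=; apply/eqP/eqP => [/wtI/ord_inj //|-> //].
have US : uniq S.
  by rewrite map_inj_uniq ?enum_uniq // => k l /wtI/ord_inj.
have hS : \sum_(nu <- S) w nu = 0.
  rewrite big_map big_enum /= -[RHS]hsum; apply: eq_bigr => k _; exact: wk.
have all0 (k : 'I_n.+1) : a 0 k *| (g x ^+ k *: v) = 0.
  rewrite -wk; apply: (weight_split (@submodule0 _ A M) US hw hS).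
  by apply/mapP; exists k; rewrite ?mem_enum.
case/eqP: a0; apply/rowP => k; rewrite mxE; apply/eqP; apply: contraT => ak0.
by have := hN k; rewrite (ksc_eq0 (all0 k) ak0) eqxx.
Qed.

(** Take a weight component of v, apply e as often as the result is nonzero, then p likewise. Since
    [e, p] = 0, the vector remains killed by e. *)
Lemma exists_singular M (N : M -> Prop) (v : M) : catOg g M -> submodule N ->
  N v -> v != 0 -> exists x mu, [/\ N x, x != 0, wvec g mu x,
    g Be *: x = 0 & g Bp *: x = 0].
Proof.
move=> [_ hM hlf] hN Nv v0.
have [s [w [us hw vE]]] := wspan_norm ((weight_moduleP g M).1 hM v).
have [mu mus wmu0] : exists2 mu, mu \in s & w mu != 0.
  apply: contrapT => h; case/eqP: v0; rewrite vE big_seq big1 // => mu mus.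
  by apply/eqP; apply: contraT => hmu; case: h; exists mu.
have Nw : N (w mu) by apply: (weight_split hN us hw) => //; rewrite -vE.
have NU (u : A) y : N y -> N (u *: y).
  by move=> hy; rewrite -[_ *: _]addr0; apply: hN.2 => //; exact: hN.1.
have [k [k0 k1]] := @exp_vanish _ _ Be _ (or_introl erefl) wmu0 (hw mu) (hlf _).
have [l [l0 l1]] := @exp_vanish _ _ Bp _ (or_intror erefl) k0 (weight_exp _ _ (hw mu)) (hlf _).
exists (g Bp ^+ l *: (g Be ^+ k *: w mu)).
exists (mu + hvee K *~ (gen_weight Be *+ k) + hvee K *~ (gen_weight Bp *+ l)); split.
- exact: (NU _ _ (NU _ _ Nw)).
- exact: l0.
- exact: (weight_exp _ _ (weight_exp _ _ (hw mu))).
- elim: l {l0 l1} => [|l IH]; first by rewrite scale1r -gen_expS.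
  by rewrite gen_expS (gen_swap gE) IH /= !(scaler0, scale0r, subr0, addr0).
- by rewrite -gen_expS.
Qed.

End LocallyFinite.

(** * Polynomial models *)

Section PolynomialModels.
Variable K : fieldType.
Implicit Types (P Q : {poly K}) (i : int).

Local Notation C i := (((i%:~R : K)%:P) : {poly K}).

(* The dual Verma module of highest weight i, with zero central charge, on which
   e acts as d/dX.  The element 1 generates its simple socle. *)
Definition nabla_fun i (x : sbasis) P : {poly K} :=
  match x with
  | Be => P^`()
  | Bh => C i * P - 2%:R * 'X * P^`()
  | Bf => C i * 'X * P - 'X ^+ 2 * P^`()
  | _ => 0
  end.

Lemma nabla_linear i x : linear (nabla_fun i x).
Proof.
move=> c P Q; case: x; rewrite /nabla_fun ?derivE -?mul_polyC ?addr0 ?mulr0 //; ring.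
Qed.
HB.instance Definition _ i x :=
  GRing.isLinear.Build K {poly K} {poly K} _ (nabla_fun i x) (nabla_linear i x).

Lemma nabla_rel i x y P :
  nabla_fun i x (nabla_fun i y P) - nabla_fun i y (nabla_fun i x P) =
  \sum_z sbracket K x y z *: nabla_fun i z P.
Proof.
rewrite (sum_sbracket (nabla_fun i ^~ P)).
by case: x; case: y; rewrite /nabla_fun /half_bracket ?derivE; ring.
Qed.

(* The Verma module of sl_2 of highest weight i, with f acting as X. *)
Definition verma_fun i (x : sbasis) P : {poly K} :=
  match x with
  | Be => C i * P^`() - 'X * P^`()^`()
  | Bh => C i * P - 2%:R * 'X * P^`()
  | Bf => 'X * P
  | _ => 0
  end.

Lemma verma_linear i x : linear (verma_fun i x).
Proof.
move=> c P Q; case: x; rewrite /verma_fun ?derivE -?mul_polyC ?addr0 ?mulr0 //; ring.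
Qed.
HB.instance Definition _ i x :=
  GRing.isLinear.Build K {poly K} {poly K} _ (verma_fun i x) (verma_linear i x).

Lemma verma_rel_fun i x y P :
  verma_fun i x (verma_fun i y P) - verma_fun i y (verma_fun i x P) =
  \sum_z sbracket K x y z *: verma_fun i z P.
Proof.
rewrite (sum_sbracket (verma_fun i ^~ P)).
by case: x; case: y; rewrite /verma_fun /half_bracket ?derivE; ring.
Qed.

(* The sl_2-maps from C^2 (x) nabla i to nabla (i + 1) and nabla (i - 1); with
   nabla i seen as the sections of O(i) on the projective line, the former is the
   multiplication by sections of O(1). *)
Definition cross_fun (up : bool) i (x : sbasis) P : {poly K} :=
  match x with
  | Bp => if up then P else P^`()
  | Bq => if up then 'X * P else 'X * P^`() - C i * P
  | _ => 0
  end.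

Definition cross_weight (up : bool) i : int := if up then i + 1 else i - 1.

Definition pair_fun up i (x : sbasis) (P : {poly K} * {poly K}) : {poly K} * {poly K} :=
  (nabla_fun i x P.1, nabla_fun (cross_weight up i) x P.2 + cross_fun up i x P.1).

Lemma pair_linear up i x : linear (pair_fun up i x).
Proof.
move=> c P Q; congr pair; first exact: linearP.
rewrite /= linearP /= scalerDr addrACA; congr (_ + _).
case: x; rewrite /cross_fun /= ?scaler0 ?addr0 //; case: up => //;
  rewrite ?derivE -?mul_polyC; ring.
Qed.
HB.instance Definition _ up i x :=
  GRing.isLinear.Build K ({poly K} * {poly K})%type ({poly K} * {poly K})%type _
    (pair_fun up i x) (pair_linear up i x).

(** p and q map the first summand to the second and kill the second, so their products vanish, as
    does z. The relations of sl_2 with p and q express the equivariance of [cross_fun]. *)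
Lemma pair_rel up i x y (P : {poly K} * {poly K}) :
  pair_fun up i x (pair_fun up i y P) - pair_fun up i y (pair_fun up i x P) =
  \sum_z sbracket K x y z *: pair_fun up i z P.
Proof.
rewrite (sum_sbracket (pair_fun up i ^~ P)); case: P => P Q.
have e : C (cross_weight up i) = C i + (if up then 1 else - 1).
  by case: up; rewrite /= ?rmorphB ?rmorphD /= -?[(-1)%:~R]/(-1) ?rmorphN ?rmorph1.
case: x; case: y; apply: injective_projections; 
  rewrite /pair_fun /half_bracket /= ?e; case: up {e} => //=; rewrite ?derivE; ring.
Qed.
End PolynomialModels.

(** * Simple highest weight modules *)

Section SimpleModules.
Variables (K : numFieldType) (A : algType K) (g : sbasis -> A).
Hypothesis gE : enveloping g.
Implicit Types (M : lmodType A) (i : int).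
Local Notation wvec := (wvec g).
Local Notation wt i := (hvee K *~ i).

(* For A = U and g = sgen, the definitions of verma_rel, Verma and L. *)
Definition vermag_rel (lam : weight K) (u : A^o) : Prop :=
  [\/ u = g Be, u = g Bp, u = g Bh - lam.1%:A | u = g Bz - lam.2%:A].

Definition Vermag (lam : weight K) : lmodType A := mod_quot (vermag_rel lam).

Definition Lg (lam : weight K) : lmodType A :=
  @mod_quot A (Vermag lam)
    (fun x => exists N, [/\ submodule N, exists y, ~ N y & N x]).

Definition L_gen (lam : weight K) : Lg lam := mod_pi _ (mod_pi (vermag_rel lam) 1).

Definition act_on M (m : M) (a : A^o) : M := (a : A) *: m.
Lemma act_on_linear M (m : M) : linear (act_on m).
Proof. by move=> a x y; rewrite /act_on scalerDl scalerA. Qed.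
HB.instance Definition _ M (m : M) :=
  GRing.isLinear.Build A A^o M _ (act_on m) (act_on_linear m).

Lemma weight_vec_wt M i (v : M) : wvec (wt i) v ->
  g Bh *: v = i%:~R *| v /\ g Bz *: v = 0.
Proof. by move=> /weight_vecP[]; rewrite (hveeE K i) /= ksc0. Qed.

Lemma weight_gen_wt M i x (v : M) : wvec (wt i) v ->
  wvec (wt (i + gen_weight x)) (g x *: v).
Proof. by rewrite mulrzDr; exact: (weight_gen gE). Qed.

Lemma linearK M (N : lmodType A) (f : {linear M -> N}) c u v :
  f (c *| u + v) = c *| f u + f v.
Proof. exact: linearP. Qed.

Inductive kspan M (S : M -> Prop) : M -> Prop :=
| kspan0 : kspan S 0
| kspan_cons c u v of S u & kspan S v : kspan S (c *| u + v).

Lemma kspanL M (S : M -> Prop) c u v : kspan S u -> kspan S v -> kspan S (c *| u + v).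
Proof.
move=> hu hv; elim: hu => [|d x y Sx _ IH]; first by rewrite scaler0 add0r.
by rewrite scalerDr kscA -addrA; apply: kspan_cons.
Qed.

Lemma kspan_mem M (S : M -> Prop) u : S u -> kspan S u.
Proof. by move=> Su; rewrite -[u]ksc1 -[_ *: _]addr0; apply: kspan_cons => //; left. Qed.

Lemma kspanD M (S : M -> Prop) u v : kspan S u -> kspan S v -> kspan S (u + v).
Proof. by move=> hu hv; rewrite -[u]ksc1; apply: kspanL. Qed.

Lemma kspanZ M (S : M -> Prop) c u : kspan S u -> kspan S (c *| u).
Proof. by move=> hu; rewrite -[_ *: _]addr0; apply: kspanL => //; left. Qed.

Lemma kspan_stable M (S : M -> Prop) (a : A) :
  (forall u, S u -> kspan S (a *: u)) -> forall v, kspan S v -> kspan S (a *: v).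
Proof.
move=> h v; elim=> [|c x y Sx _ IH]; first by rewrite scaler0; left.
by rewrite scalerDr ksc_comm; apply: kspanL => //; exact: h.
Qed.

Lemma kspan_cyclic M (S : M -> Prop) (m : M) : S m ->
  (forall x u, S u -> kspan S (g x *: u)) -> forall a : A, kspan S (a *: m).
Proof.
move=> Sm h a; apply: (U_closed gE); first by left.
- by move=> c u v; exact: kspanL.
- by move=> x v; apply: kspan_stable => u; exact: h.
- exact: kspan_mem.
Qed.

Section VermaSpan.
Variables (M : lmodType A) (i : int) (m : M).
Hypotheses (hm : wvec (wt i) m) (em : g Be *: m = 0) (pm : g Bp *: m = 0).

Definition verma_mon (v : M) := exists a b, v = g Bf ^+ a *: (g Bq ^+ b *: m).

Lemma weight_verma_mon a b :
  wvec (wt (i - a.*2%:Z - b%:Z)) (g Bf ^+ a *: (g Bq ^+ b *: m)).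
Proof.
have -> : i - a.*2%:Z - b%:Z = i + gen_weight Bq *+ b + gen_weight Bf *+ a.
  rewrite /= -[_ *+ b]mulr_natr -[_ *+ a]mulr_natr !natz; lia.
by rewrite !mulrzDr; do 2!apply: (weight_exp gE).
Qed.

(** On these weights z acts as 0, so p commutes with q, and [e, q] = p then gives the claim for
    e. *)
Lemma verma_mon_q0 b : g Bp *: (g Bq ^+ b *: m) = 0 /\ g Be *: (g Bq ^+ b *: m) = 0.
Proof.
elim: b => [|b [IHp IHe]]; first by rewrite scale1r.
have [_ hz] := weight_vec_wt (weight_verma_mon 0 b).
rewrite scale1r in hz.
by rewrite gen_expS !(gen_swap gE _ Bq) IHp IHe /= hz scale0r !(scaler0, subr0, addr0).
Qed.

(** The spanning part of a PBW argument: f and q commute, p f = f p - q and e f = f e + h, so every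
    generator can be moved to the right through the powers of f. *)
Lemma verma_mon_stable x v : verma_mon v -> kspan verma_mon (g x *: v).
Proof.
have mon a b : kspan verma_mon (g Bf ^+ a *: (g Bq ^+ b *: m)).
  by apply: kspan_mem; exists a, b.
have qf a b : g Bq *: (g Bf ^+ a *: (g Bq ^+ b *: m)) =
    g Bf ^+ a *: (g Bq ^+ b.+1 *: m).
  elim: a => [|a IH]; first by rewrite !scale1r gen_expS.
  by rewrite !gen_expS (gen_swap gE) IH /= subrr addr0 gen_expS.
have fst v' : kspan verma_mon v' -> kspan verma_mon (g Bf *: v').
  by apply: kspan_stable => _ [a' [b' ->]]; rewrite -gen_expS.
have hst a b : kspan verma_mon (g Bh *: (g Bf ^+ a *: (g Bq ^+ b *: m))).
  by have [-> _] := weight_vec_wt (weight_verma_mon a b); apply: kspanZ.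
have pf a b : kspan verma_mon (g Bp *: (g Bf ^+ a *: (g Bq ^+ b *: m))).
  elim: a => [|a IH]; first by rewrite scale1r (verma_mon_q0 b).1; left.
  rewrite gen_expS (gen_swap gE) /= scale0r sub0r qf -[- _]ksc1 scalerN -kscNl.
  by apply: kspanD; [exact: fst|exact: kspanZ].
move=> [a [b ->]]; case: x => //.
- elim: a => [|a IH]; first by rewrite scale1r (verma_mon_q0 b).2; left.
  rewrite gen_expS (gen_swap gE) /= scale0r subr0.
  by apply: kspanD; [exact: fst|exact: hst].
- by rewrite -gen_expS.
- by rewrite qf.
- by have [_ ->] := weight_vec_wt (weight_verma_mon a b); left.
Qed.

(** f^k q^l m has weight i - 2k - l, which equals i only for k = l = 0. *)
Lemma verma_decomp (a : A) : exists c (s : seq (weight K * M)),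
  (forall p, p \in s -> wvec p.1 p.2 /\ p.1 != wt i) /\
  a *: m = c *| m + \sum_(p <- s) p.2.
Proof.
have : kspan verma_mon (a *: m).
  apply: kspan_cyclic; first by exists 0, 0; rewrite !scale1r.
  by move=> x v; exact: verma_mon_stable.
elim=> [|c _ v [k [l ->]] _ [d [s [hs ->]]]].
  by exists 0, [::]; rewrite ksc0 big_nil addr0; split.
have [+|kl] := boolP ((k.*2 + l)%N == 0%N).
  rewrite addn_eq0 double_eq0 => /andP[/eqP-> /eqP->]; exists (c + d), s.
  by rewrite !scale1r kscDl addrA.
exists d, ((wt (i - k.*2%:Z - l%:Z) : weight K, c *| (g Bf ^+ k *: (g Bq ^+ l *: m))) :: s).
rewrite big_cons /= addrCA; split=> // p; rewrite inE => /orP[/eqP->|/hs] //=.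
split; first exact/weight_vecZ/weight_verma_mon.
by apply/eqP => /(@hvee_inj K); lia.
Qed.
End VermaSpan.

Section HighestWeightSpan.

Definition fpoly M (P : {poly K}) (y : M) : M :=
  \sum_(k < size P) P`_k *| (g Bf ^+ k *: y).

Lemma fpolyEw n M (P : {poly K}) (y : M) : (size P <= n)%N ->
  fpoly P y = \sum_(k < n) P`_k *| (g Bf ^+ k *: y).
Proof.
move=> le; rewrite /fpoly (big_ord_widen n (fun k => P`_k *| (g Bf ^+ k *: y))) //.
rewrite big_mkcond; apply: eq_bigr => k _; case: ltnP => // h.
by rewrite nth_default // ksc0.
Qed.

Lemma fpolyL M c P Q (y : M) : fpoly (c *: P + Q) y = c *| fpoly P y + fpoly Q y.
Proof.
pose n := maxn (size P) (size Q).
rewrite (@fpolyEw n _ P) ?leq_maxl // (@fpolyEw n _ Q) ?leq_maxr //.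
rewrite (@fpolyEw n); last first.
  apply: leq_trans (size_polyD _ _) _; rewrite geq_max leq_maxr andbT.
  by apply: leq_trans (size_scale_leq _ _) _; exact: leq_maxl.
rewrite scaler_sumr -big_split; apply: eq_bigr => k _.
by rewrite /= coefD coefZ kscA kscDl.
Qed.

Lemma fpolyXn M k (y : M) : fpoly 'X^k y = g Bf ^+ k *: y.
Proof.
rewrite /fpoly size_polyXn big_ord_recr /= coefXn eqxx ksc1 big1 ?add0r // => j _.
by rewrite coefXn ltn_eqF ?ksc0.
Qed.

Lemma fpoly_lin M (N : lmodType A) (f : {linear M -> N}) P y :
  f (fpoly P y) = fpoly P (f y).
Proof.
by rewrite /fpoly linear_sum; apply: eq_bigr => k _; rewrite !linearZ_LR.
Qed.

(** The polynomials in f that represent the elements of L(i): degree at most i for i >= 0, arbitrary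
    for i < 0. *)
Definition lrange i (P : {poly K}) : bool := (i < 0) || (size P <= `|i|.+1)%N.

Lemma lrangeL i c P Q : lrange i P -> lrange i Q -> lrange i (c *: P + Q).
Proof.
move=> /orP[i0 _|hP /orP[i0|hQ]]; try by rewrite /lrange i0.
apply/orP; right; apply: leq_trans (size_polyD _ _) _; rewrite geq_max hQ andbT.
exact: leq_trans (size_scale_leq _ _) hP.
Qed.

Lemma lrangeXn i k : lrange i 'X^k = (i < 0) || (k <= `|i|)%N.
Proof. by rewrite /lrange size_polyXn. Qed.

Variables (M : lmodType A) (i : int) (y : M).
Hypotheses (hy : wvec (wt i) y) (ey : g Be *: y = 0) (py : g Bp *: y = 0)
  (qy : g Bq *: y = 0) (fy : 0 <= i -> g Bf ^+ `|i|.+1 *: y = 0).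

Lemma hw_weight k : wvec (wt (i - k.*2%:Z)) (g Bf ^+ k *: y).
Proof.
have -> : i - k.*2%:Z = i + gen_weight Bf *+ k.
  by clear; rewrite /= -[_ *+ k]mulr_natr !natz; lia.
by rewrite mulrzDr; apply: (weight_exp gE).
Qed.

Lemma hw_q k : g Bq *: (g Bf ^+ k *: y) = 0.
Proof.
elim: k => [|k IH]; first by rewrite scale1r.
by rewrite gen_expS (gen_swap gE) IH scaler0 /= subrr addr0.
Qed.

Lemma hw_p k : g Bp *: (g Bf ^+ k *: y) = 0.
Proof.
elim: k => [|k IH]; first by rewrite scale1r.
by rewrite gen_expS (gen_swap gE) IH scaler0 /= scale0r hw_q subrr addr0.
Qed.

Definition fspan (v : M) := exists2 P, lrange i P & v = fpoly P y.

Lemma fspanL c u v : fspan u -> fspan v -> fspan (c *| u + v).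
Proof.
by move=> [P hP ->] [Q hQ ->]; exists (c *: P + Q); rewrite ?lrangeL ?fpolyL.
Qed.

Lemma fspan0 : fspan 0.
Proof.
exists 0; first by rewrite /lrange size_poly0 orbT.
by rewrite /fpoly size_poly0 big_ord0.
Qed.

Lemma fspan_mon k : fspan (g Bf ^+ k *: y).
Proof.
have [h|] := boolP (lrange i 'X^k); first by exists 'X^k; rewrite ?fpolyXn.
rewrite lrangeXn negb_or -leNgt -ltnNge => /andP[i0 ik].
by rewrite -(subnK ik) exprD -scalerA fy // scaler0; exact: fspan0.
Qed.

Lemma fspan_stable (a : A) : (forall k, fspan (a *: (g Bf ^+ k *: y))) ->
  forall v, fspan v -> fspan (a *: v).
Proof.
move=> h _ [P _ ->]; rewrite /fpoly scaler_sumr; elim/big_ind: _ => [|u v hu hv|k _].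
- exact: fspan0.
- by rewrite -[u]ksc1; apply: fspanL.
- by rewrite ksc_comm -[_ *: _]addr0; apply: fspanL => //; exact: fspan0.
Qed.

(** As [p, f] = -q and [q, f] = 0, both p and q kill every f^k y, and the span of these vectors is
    stable under e by [e, f] = h. *)
Lemma hw_span (a : A) : fspan (a *: y).
Proof.
apply: (U_closed gE); [exact: fspan0|by move=> *; apply: fspanL| |]; last first.
  by have := fspan_mon 0; rewrite scale1r.
have fst v : fspan v -> fspan (g Bf *: v).
  by apply: fspan_stable => k; rewrite -gen_expS; exact: fspan_mon.
have hst k : fspan (g Bh *: (g Bf ^+ k *: y)).
  have [-> _] := weight_vec_wt (hw_weight k).
  by rewrite -[_ *: _]addr0; apply: fspanL; [exact: fspan_mon|exact: fspan0].
move=> x v; apply: fspan_stable => k; case: x => //; last first.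
- by have [_ ->] := weight_vec_wt (hw_weight k); exact: fspan0.
- by rewrite hw_q; exact: fspan0.
- by rewrite hw_p; exact: fspan0.
- by apply: fst; exact: fspan_mon.
elim: k => [|k IH]; first by rewrite scale1r ey; exact: fspan0.
rewrite gen_expS (gen_swap gE) /= scale0r subr0 -[X in X + _]ksc1.
by apply: fspanL; [exact: fst|exact: hst].
Qed.
End HighestWeightSpan.

End SimpleModules.

(** * Cyclic modules embedded in a dual Verma module *)

Section PolynomialModel.
Variables (K : numFieldType) (A : algType K) (g : sbasis -> A).
Hypothesis gE : enveloping g.
Implicit Types (M X : lmodType A) (i : int).
Local Notation wvec := (wvec g).
Local Notation wt i := (hvee K *~ i).
Local Notation Lg := (Lg g).

Lemma env_module (V : lmodType K) (op : sbasis -> {linear V -> V}) :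
  (forall x y v, op x (op y v) - op y (op x v) =
     \sum_i sbracket K x y i *: op i v) ->
  exists (M : lmodType A) (psi : M -> V), [/\ injective psi,
    forall v, exists m, psi m = v,
    forall c u v, psi (c *| u + v) = c *: psi u + psi v &
    forall x m, psi (g x *: m) = op x (psi m)].
Proof.
move=> /(env_rep gE)[M [phi [[psi phiK psiK] phiL phig]]].
exists M, psi; split.
- exact: can_inj psiK.
- by move=> v; exists (phi v).
- by move=> c u v; apply: (can_inj phiK); rewrite phiL !psiK.
- by move=> x m; apply: (can_inj phiK); rewrite phig !psiK.
Qed.

(* u embeds X in the dual Verma module of highest weight i, so that X is simple,
   of highest weight i and generated by x0. *)
Record poly_model X i (x0 : X) (u : X -> {poly K}) : Prop := PolyModel {
  pm_lin : forall c x y, u (c *| x + y) = c *: u x + u y;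
  pm_inj : injective u;
  pm_gen : forall x v, u (g x *: v) = nabla_fun i x (u v);
  pm_gen1 : u x0 = 1;
  pm_cyc : forall v, exists a : A, v = a *: x0 }.

(** The falling factorial i (i - 1) ... (i - k + 1), by which f^k sends 1 to a multiple of X^k in
    the dual Verma module. It vanishes exactly when 0 <= i < k, which bounds the degree in L(i). *)
Definition fcoef i k : K := \prod_(l < k) (i%:~R - l%:R).

Lemma fcoef_neq0 i k : (i < 0) || (k <= `|i|)%N -> fcoef i k != 0.
Proof.
move=> h; apply/prodf_neq0 => l _; rewrite -[l%:R]/((l%:Z)%:~R) -rmorphB intr_eq0.
by have := ltn_ord l; case/orP: h; lia.
Qed.

Lemma fcoef_eq0 i k : 0 <= i -> (`|i| < k)%N -> fcoef i k = 0.
Proof.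
move=> i0 ik; rewrite /fcoef (bigD1 (Ordinal ik)) //= [X in X * _](_ : _ = 0) ?mul0r //.
by rewrite -[X in _ - X]/((`|i|%:Z)%:~R) gez0_abs // subrr.
Qed.

Lemma nabla_fX i (c : K) k :
  nabla_fun i Bf (c *: 'X^k) = (c * (i%:~R - k%:R)) *: 'X^(k.+1).
Proof.
have e : 'X ^+ 2 * ('X^(k.-1) *+ k) = k%:R *: 'X^(k.+1) :> {poly K}.
  case: k => [|k]; first by rewrite mulr0 scale0r.
  by rewrite mulrnAr -exprD scaler_nat.
rewrite /= derivZ derivXn -(scalerAr c ('X ^+ 2)) e -mulrA mul_polyC -scalerAr -exprS.
by rewrite !scalerA -scalerBl mulrBr [i%:~R * c]mulrC.
Qed.

Section Theory.
Variables (X : lmodType A) (i : int) (x0 : X) (u : X -> {poly K}).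
Hypothesis pm : poly_model i x0 u.

Lemma pm0 : u 0 = 0.
Proof.
by have := pm_lin pm (-1) 0 0; rewrite scaler0 addr0 scaleN1r addNr.
Qed.

Lemma pmZ c v : u (c *| v) = c *: u v.
Proof. by rewrite -[_ *: _]addr0 (pm_lin pm) pm0 addr0. Qed.

Lemma pm_neq0 v : v != 0 -> u v != 0.
Proof. by apply: contraNN => /eqP h; apply/eqP/(pm_inj pm); rewrite pm0. Qed.

Lemma pm_gen1_neq0 : x0 != 0.
Proof. by apply/eqP => h; have := pm_gen1 pm; rewrite h pm0 => /eqP; rewrite eq_sym oner_eq0. Qed.

Lemma pm_hw : [/\ wvec (wt i) x0, g Be *: x0 = 0, g Bp *: x0 = 0 & g Bq *: x0 = 0].
Proof.
have h x : nabla_fun i x (1 : {poly K}) = 0 -> g x *: x0 = 0.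
  by move=> h; apply: (pm_inj pm); rewrite (pm_gen pm) pm0 (pm_gen1 pm).
split; [|by apply: h; rewrite /= ?derivE..].
apply/weight_vecP; rewrite (hveeE K i) /= ksc0; split; apply: (pm_inj pm).
  by rewrite (pm_gen pm) pmZ (pm_gen1 pm) /= derivE mulr0 subr0 mul_polyC.
by rewrite (pm_gen pm) pm0.
Qed.

Lemma pm_exp k : u (g Bf ^+ k *: x0) = fcoef i k *: 'X^k.
Proof.
elim: k => [|k IH].
  by rewrite scale1r (pm_gen1 pm) /fcoef big_ord0 scale1r expr0.
by rewrite gen_expS (pm_gen pm) IH nabla_fX /fcoef big_ord_recr.
Qed.

Lemma pm_expf0 : 0 <= i -> g Bf ^+ `|i|.+1 *: x0 = 0.
Proof.
by move=> i0; apply: (pm_inj pm); rewrite pm_exp fcoef_eq0 // scale0r pm0.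
Qed.

Lemma pm_fpoly (P : {poly K}) : u (fpoly g P x0) = \poly_(k < size P) (P`_k * fcoef i k).
Proof.
rewrite poly_def /fpoly.
rewrite (big_morph u (id1 := 0) (op1 := +%R)) ?pm0 //; last first.
  by move=> a b; have := pm_lin pm 1 a b; rewrite ksc1 scale1r.
by apply: eq_bigr => k _; rewrite pmZ pm_exp scalerA.
Qed.

Lemma pm_span v : exists2 P, lrange i P & v = fpoly g P x0.
Proof.
have [a ->] := pm_cyc pm v; have [hw e0 p0 q0] := pm_hw.
exact: (hw_span gE hw e0 p0 q0 pm_expf0).
Qed.

Lemma pm_im (Q : {poly K}) : lrange i Q <-> exists v, u v = Q.
Proof.
split=> [hQ|[v <-]]; last first.
  have [P hP ->] := pm_span v; rewrite pm_fpoly /lrange.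
  case/orP: hP => [->//|hP]; apply/orP; right.
  exact: leq_trans (size_poly _ _) hP.
(* f^k x0 corresponds to [fcoef i k] times X^k, and this factor is invertible for every exponent in
   the range. *)
exists (\sum_(k < size Q) (Q`_k / fcoef i k) *| (g Bf ^+ k *: x0)).
rewrite (big_morph u (id1 := 0) (op1 := +%R)) ?pm0 //; last first.
  by move=> a b; have := pm_lin pm 1 a b; rewrite ksc1 scale1r.
rewrite -[RHS]coefK poly_def; apply: eq_bigr => k _.
rewrite pmZ pm_exp scalerA divfK // fcoef_neq0 //.
by case/orP: hQ => [->//|h]; rewrite -ltnS (leq_trans (ltn_ord k) h) orbT.
Qed.

Definition ann_rel i (a : A^o) : Prop :=
  [\/ vermag_rel g (wt i) a, a = g Bq | 0 <= i /\ a = g Bf ^+ `|i|.+1].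

Lemma ann_rel0 (a : A) : ann_rel i a -> a *: x0 = 0.
Proof.
have [hw e0 p0 q0] := pm_hw; have [h0 z0] := weight_vec_wt hw.
case=> [[]||[i0 ->]]; last exact: pm_expf0.
- by move=> ->.
- by move=> ->.
- by move=> ->; rewrite (hveeE K i) scalerBl h0 subrr.
- by move=> ->; rewrite (hveeE K i) /= scale0r subr0.
- by move=> ->.
Qed.

(** In the quotient of A by the left ideal of the listed relations, [hw_span] applies to the class
    of 1, so a is congruent to some P(f) with P in the range of L(i). From P(f) x0 = a x0 = 0 each
    coefficient of P times a nonzero [fcoef] vanishes, hence P = 0. *)
Lemma ann_gen (a : A) : a *: x0 = 0 -> submod_gen (ann_rel i) (a : A^o).
Proof.
move=> a0; pose Q := mod_quot (ann_rel i); pose y0 : Q := mod_pi (ann_rel i) 1.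
have piE (b : A) : b *: y0 = mod_pi (ann_rel i) (b : A^o).
  by rewrite -[LHS]mod_piZ /GRing.scale /= mulr1.
have y0E (b : A) : ann_rel i b -> b *: y0 = 0.
  move=> hb; rewrite piE -[RHS](linear0 (@mod_pi _ _ (ann_rel i))).
  by apply/mod_piP; rewrite subr0; exact: submod_gen_in.
have hw : wvec (wt i) y0.
  apply/weight_vecP; rewrite (hveeE K i); split; apply/eqP; rewrite -subr_eq0 -scalerBl;
    by apply/eqP/y0E/Or31; rewrite (hveeE K i); first [exact: Or43|exact: Or44].
have e0 : g Be *: y0 = 0 by apply: y0E; apply/Or31/Or41.
have p0 : g Bp *: y0 = 0 by apply: y0E; apply/Or31/Or42.
have q0 : g Bq *: y0 = 0 by apply: y0E; exact: Or32.
have f0 : 0 <= i -> g Bf ^+ `|i|.+1 *: y0 = 0 by move=> i0; apply: y0E; exact: Or33.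
have [P hP aP] := hw_span gE hw e0 p0 q0 f0 a.
pose b : A := fpoly g P (1 : A^o).
have bE (N : lmodType A) (m : N) : b *: m = fpoly g P m.
  by rewrite -[b *: m]/(act_on m b) /b fpoly_lin /= /act_on scale1r.
have hab : submod_gen (ann_rel i) ((a - b) : A^o).
  by apply/mod_piP; rewrite -!piE bE.
have P0 : P = 0.
  have h : (a - b) *: x0 = 0.
    elim: hab => [c /ann_rel0//||c v w _ hv _ hw']; first by rewrite scale0r.
    by rewrite scalerDl -[c *: v]/(c * v) -scalerA hv hw' scaler0 addr0.
  move: h; rewrite scalerBl a0 bE sub0r => /eqP; rewrite oppr_eq0 => /eqP h.
  have := congr1 u h; rewrite pm_fpoly pm0 => h'.
  apply/polyP => k; rewrite coef0; have := congr1 (fun R : {poly K} => R`_k) h'.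
  rewrite coef_poly coef0; case: ltnP => hk; last by rewrite nth_default.
  move/eqP; rewrite mulf_eq0 (negPf (fcoef_neq0 _)) ?orbF; first by move/eqP.
  by case/orP: hP => [->//|hP]; rewrite -ltnS (leq_trans hk hP) orbT.
by move: hab; rewrite /b P0 /fpoly size_poly0 big_ord0 subr0.
Qed.

End Theory.

Lemma deriv_eq0 (P : {poly K}) : P^`() = 0 -> P = (P`_0)%:P.
Proof.
move=> h; apply/polyP => -[|k]; rewrite coefC //=.
have := coef_deriv P k; rewrite h coef0 => /esym/eqP.
by rewrite mulrn_eq0 /= => /eqP.
Qed.

Lemma nabla_iter_deriv i (P : {poly K}) : P != 0 ->
  exists k c, c != 0 /\ iter k (nabla_fun i Be) P = c%:P.
Proof.
elim/ltn_ind: {P}(size P) {-2}P (erefl (size P)) => n IH P sP P0.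
have [d0|d0] := eqVneq P^`() 0.
  have e := deriv_eq0 d0; exists 0, P`_0; split=> //.
  by apply: contraNneq P0 => e0; rewrite e e0 polyC0.
have [||k [c [c0 hk]]] := IH (size P^`()) _ P^`() erefl; last first.
- by exists k.+1, c; rewrite iterSr.
- exact: d0.
- by rewrite -sP lt_size_deriv.
Qed.

(* The kernel of the map from the Verma module to the dual Verma module contains
   every proper submodule: a vector outside it is moved by a power of e to a vector
   with a nonzero component along the generator. *)
Lemma L_model i : exists u, poly_model i (L_gen g (wt i)) u.
Proof.
have [M [psi [psiI psiS psiL psig]]] := env_module (nabla_rel i).
have psi0 : psi 0 = 0.
  by have := psiL (-1) 0 0; rewrite scaler0 addr0 scaleN1r addNr.
have [m0 m1] := psiS 1.
have psiZ c v : psi (c *| v) = c *: psi v by rewrite -[_ *: _]addr0 psiL psi0 addr0.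
have hw : wvec (wt i) m0.
  apply/weight_vecP; rewrite (hveeE K i) /= ksc0; split; apply: (psiI).
    by rewrite psig psiZ m1 /= derivE mulr0 subr0 mul_polyC.
  by rewrite psig psi0.
have em : g Be *: m0 = 0 by apply: (psiI); rewrite psig psi0 m1 /= derivE.
have pm : g Bp *: m0 = 0 by apply: (psiI); rewrite psig psi0.
have m00 : m0 != 0.
  by apply/eqP => h; move: m1; rewrite h psi0 => /eqP; rewrite eq_sym oner_eq0.
have [|F FE] := @mod_quot_lift _ _ (vermag_rel g (wt i)) _ (act_on m0).
  have [hm zm] := weight_vec_wt hw.
  move=> s; rewrite /= /act_on (hveeE K i) => -[->|->|->|->] //.
    by rewrite scalerBl hm subrr.
  by rewrite scalerBl zm ksc0 subr0.
pose v0 : Vermag g (wt i) := mod_pi _ 1.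
have piE (a : A) : a *: v0 = mod_pi (vermag_rel g (wt i)) (a : A^o).
  by rewrite -[LHS]mod_piZ /GRing.scale /= mulr1.
have Fv0 : F v0 = m0 by rewrite FE /= /act_on scale1r.
have v0E (b : A) : vermag_rel g (wt i) b -> b *: v0 = 0.
  move=> hb; rewrite piE -[RHS](linear0 (@mod_pi _ _ (vermag_rel g (wt i)))).
  by apply/mod_piP; rewrite subr0; exact: submod_gen_in.
have hv0 : wvec (wt i) v0.
  apply/weight_vecP; split; apply/eqP; rewrite -subr_eq0 -scalerBl;
    by apply/eqP/v0E; first [exact: Or43|exact: Or44].
have ev0 : g Be *: v0 = 0 by apply: v0E; exact: Or41.
have pv0 : g Bp *: v0 = 0 by apply: v0E; exact: Or42.
have cyc v : exists a : A, v = a *: v0.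
  by rewrite -[v]mod_piK; exists (repr v : A); rewrite piE.
(* Only the component c v0 of weight i matters: if c were 0, then m0 = F n would be a sum of vectors
   of weights other than i. *)
have gen_in (N : Vermag g (wt i) -> Prop) n : submodule N -> N n -> F n = m0 -> N v0.
  move=> hN Nn Fn; have [a aE] := cyc n.
  have [c [s [hs nE]]] := verma_decomp gE hv0 ev0 pv0 a.
  move: Nn Fn; rewrite aE nE => /(weight_lead hN (weight_vecZ c hv0) hs) Nc.
  have [c0|c0] := eqVneq c 0; last first.
    by move=> _; rewrite -[v0]ksc1 -(mulVf c0) -kscA -[_ *: _]addr0; apply: hN.2 => //; exact: hN.1.
  rewrite c0 ksc0 add0r linear_sum => Fn.
  have := @weight_lead _ _ g M (fun v => v = 0) _ m0 [seq (p.1, - F p.2) | p <- s]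
    (submodule0 _) hw.
  rewrite big_map sumrN Fn subrr => h; case/eqP: m00; apply: h => // p /mapP[q /hs[q1 q2] ->].
  split=> //=; rewrite -[F _]ksc1 -kscNl; apply/weight_vecZ/weight_vec_lin => //.
have Fker x : (exists N, [/\ submodule N, exists y, ~ N y & N x]) -> F x = 0.
  move=> [N [hN [y Ny] Nx]]; apply: (psiI); rewrite psi0.
  apply/eqP; apply: contraT => /(nabla_iter_deriv i)[k [c [c0 hk]]]; case: Ny.
  have NU (a : A) v : N v -> N (a *: v).
    by move=> hv; rewrite -[_ *: _]addr0; apply: hN.2 => //; exact: hN.1.
  have [a ->] := cyc y; apply: (NU).
  apply: (gen_in N (c^-1 *| (g Be ^+ k *: x))) => //; first by do 2!apply: (NU).
  apply: (psiI); rewrite !linearZ_LR psiZ m1.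
  have -> : psi (g Be ^+ k *: F x) = c%:P.
    rewrite -hk; elim: k {hk} => [|k IH]; first by rewrite scale1r.
    by rewrite gen_expS psig IH.
  by rewrite -mul_polyC -polyCM mulVf.
have [G GE] := @mod_quot_lift _ _ _ _ F Fker.
exists (fun v => psi (G v)); split.
- by move=> c x y; rewrite linearK psiL.
(* A vector killed by F lies in the kernel of F, a proper submodule because F v0 = m0 is nonzero, so
   its class in L is 0. *)
- move=> x y /psiI /eqP; rewrite -subr_eq0 -linearB => /eqP h.
  apply/eqP; rewrite -subr_eq0; apply/eqP; move: h; rewrite -[x - y]mod_piK GE.
  move: (repr _) => v Fv; rewrite -[RHS](linear0 (@mod_pi _ _ _)).
  apply/mod_piP; rewrite subr0; apply: submod_gen_in; exists (fun v => F v = 0).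
  split=> //; last by exists v0; rewrite Fv0; exact/eqP.
  by split=> [|a b c hb hc]; rewrite ?linear0 // linearP hb hc scaler0 addr0.
- by move=> x v; rewrite linearZ_LR psig.
- by rewrite GE Fv0.
- move=> v; rewrite -[v]mod_piK; have [a ->] := cyc (repr v).
  by exists a; rewrite linearZ_LR.
Qed.

End PolynomialModel.

(** * Extensions of a cyclic module *)

Section Extensions.
Variables (K : fieldType) (A : algType K).
Implicit Types (M N X Y W : lmodType A).

Lemma sval_linear M (P : M -> Prop) (hP : submodule P) a (u v : sub_mod hP) :
  sval (a *: u + v) = a *: sval u + sval v.
Proof. exact: (linearP (val : {linear sub_mod hP -> M})). Qed.

(** Homomorphisms out of cyclic modules and extensions are given by their graphs; well-definedness
    then reduces to the fibre over 0. *)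
Lemma linear_graph M N (R : M -> N -> Prop) :
  (forall m, exists n, R m n) ->
  (forall a m n m' n', R m n -> R m' n' -> R (a *: m + m') (a *: n + n')) ->
  (forall n, R 0 n -> n = 0) ->
  exists f : {linear M -> N}, (forall m, R m (f m)) /\ forall m n, R m n -> f m = n.
Proof.
move=> /choice[f fR] RL R0.
have RU m n : R m n -> f m = n.
  move=> Rn; apply/eqP; rewrite -subr_eq0; apply/eqP/R0.
  have := RL (-1) _ _ _ _ Rn (fR m).
  by rewrite !scaleN1r addNr addrC.
have fL : linear f by move=> a x y; apply: RU; exact: RL.
by exists (HB.pack_for {linear M -> N} f (GRing.isLinear.Build A M N _ f fL)).
Qed.

Lemma extension_split X Y (E : extension X Y) m0 x0 : prj E m0 = x0 ->
  (forall x, exists a, x = a *: x0) -> forall m, exists y (a : A), m = inc E y + a *: m0.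
Proof.
move=> pm cyc m; have [a pa] := cyc (prj E m).
have [|y yE] := (inc_prj_exact (e := E) (m - a *: m0)).1.
  by rewrite linearB linearZ_LR pm pa /= subrr.
by exists y, a; rewrite yE subrK.
Qed.

(* An extension of a cyclic module is determined by the action of the
   annihilator of the generator on a lift of it. *)
Lemma ext_eq_cyclic X Y (E E' : extension X Y) x0 m0 m0' :
  (forall x, exists a, x = a *: x0) -> prj E m0 = x0 -> prj E' m0' = x0 ->
  (forall a : A, a *: x0 = 0 ->
     exists y, a *: m0 = inc E y /\ a *: m0' = inc E' y) ->
  ext_eq E E'.
Proof.
move=> cyc pm pm' h.
pose R m m' := exists y (a : A), m = inc E y + a *: m0 /\ m' = inc E' y + a *: m0'.
have [m||m' [y [a [e ->]]]|f [fR fU]] := @linear_graph (mid E) (mid E') R.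
- have [y [a ->]] := extension_split pm cyc m.
  by exists (inc E' y + a *: m0'), y, a.
- move=> b m n m' n' [y [a [-> ->]]] [y' [a' [-> ->]]].
  exists (b *: y + y'), (b * a + a').
  by rewrite !linearP !scalerDl !scalerDr -!scalerA; split; rewrite addrACA.
- have a0 : a *: x0 = 0.
    have := congr1 (prj E) e; rewrite linear0 linearD linearZ_LR pm.
    by rewrite (inc_prj_exact (e := E) _).2 ?add0r //; exists y.
  have [y' [ey ->]] := h a a0; rewrite -linearD.
  suff -> : y + y' = 0 by rewrite linear0.
  have : inc E (y + y') = inc E 0 by rewrite linearD linear0 -ey -e.
  by move/Defs.inc_inj.
exists f; split=> [y|m].
  by apply: fU; exists y, 0; rewrite !scale0r !addr0.
have [y [a [-> ->]]] := fR m; rewrite !linearD !linearZ_LR pm pm'.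
by rewrite (inc_prj_exact (e := E) _).2 ?(inc_prj_exact (e := E') _).2 //; exists y.
Qed.

(* The submodule of W (+) X generated by (w, x0) and iota Y is an extension of X
   by Y as soon as the annihilator of x0 maps w into iota Y. *)
Section CyclicExtension.
Variables (X Y W : lmodType A) (x0 : X) (iota : {linear Y -> W}) (w : W).

Definition ext_pred (m : W * X) : Prop :=
  exists y (a : A), m = (iota y + a *: w, a *: x0).

Lemma ext_pred_submodule : submodule ext_pred.
Proof.
split; first by exists 0, 0; rewrite linear0 !scale0r addr0.
move=> b _ _ [y [a ->]] [y' [a' ->]]; exists (b *: y + y'), (b * a + a').
by rewrite linearP !scalerDl -!scalerA; congr pair => /=; rewrite scalerDr addrACA.
Qed.

Definition ext_mid : lmodType A := sub_mod ext_pred_submodule.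

Lemma ext_inc_subproof y : sub_pred ext_pred_submodule (iota y, 0).
Proof. by apply/asboolP; exists y, 0; rewrite !scale0r addr0. Qed.

Definition ext_inc (y : Y) : ext_mid := exist _ (iota y, 0) (ext_inc_subproof y).
Definition ext_prj (m : ext_mid) : X := (sval m).2.

Lemma ext_inc_linear : linear ext_inc.
Proof.
move=> a y y'; apply: val_inj; rewrite linearP /=; congr pair.
  by rewrite linearP.
by rewrite /= scaler0 addr0.
Qed.
HB.instance Definition _ := GRing.isLinear.Build A Y ext_mid _ ext_inc ext_inc_linear.

Lemma ext_prj_linear : linear ext_prj.
Proof. by move=> a m m'; rewrite /ext_prj sval_linear. Qed.
HB.instance Definition _ := GRing.isLinear.Build A ext_mid X _ ext_prj ext_prj_linear.

Hypotheses (cyc : forall x, exists a, x = a *: x0) (iotaI : injective iota)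
  (hw : forall a : A, a *: x0 = 0 -> exists y, a *: w = iota y).

Lemma ext_inc_inj : injective ext_inc.
Proof. by move=> y y' [] /iotaI. Qed.

Lemma ext_gen_subproof : sub_pred ext_pred_submodule (w, x0).
Proof. by apply/asboolP; exists 0, 1; rewrite !scale1r linear0 add0r. Qed.
Definition ext_gen : ext_mid := exist _ (w, x0) ext_gen_subproof.

Lemma ext_prj_surj x : exists m, ext_prj m = x.
Proof. by have [a ->] := cyc x; exists (a *: ext_gen). Qed.

Lemma ext_exact m : ext_prj m = 0 <-> exists y, ext_inc y = m.
Proof.
split=> [|[y <-] //]; case: m => m mP; rewrite /ext_prj /= => m0.
have /asboolP[y [a mE]] := mP.
have [|y' wE] := hw (a := a); first by rewrite -m0 mE.
exists (y + y'); apply: val_inj; rewrite /= linearD -wE; move: m0.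
by rewrite mE /= => ->.
Qed.

Definition ext_of : extension X Y := Extension ext_inc_inj ext_prj_surj ext_exact.

End CyclicExtension.

Section CyclicExtensionMap.
Variables (X Y W Y' W' : lmodType A) (x0 : X).
Variables (iota : {linear Y -> W}) (w : W) (iota' : {linear Y' -> W'}) (w' : W').
Hypotheses (cyc : forall x, exists a, x = a *: x0)
  (iotaI : injective iota) (iotaI' : injective iota')
  (hw : forall a : A, a *: x0 = 0 -> exists y, a *: w = iota y)
  (hw' : forall a : A, a *: x0 = 0 -> exists y, a *: w' = iota' y).

Lemma ext_of_map (F : W -> W') (b : Y -> Y') : linear F ->
  (forall y, F (iota y) = iota' (b y)) -> F w = w' ->
  ext_hom (ext_of cyc iotaI hw) (ext_of cyc iotaI' hw') b id.
Proof.
move=> FL Fi Fw.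
have FP a u v : F (a *: u + v) = a *: F u + F v := FL a u v.
have F0 : F 0 = 0 by have := FP (-1) 0 0; rewrite scaler0 addr0 scaleN1r addNr.
pose R (m : ext_mid x0 iota w) (m' : ext_mid x0 iota' w') :=
  sval m' = (F (sval m).1, (sval m).2).
have [[m mP]|a m n m' n'|n|f [fR fU]] := @linear_graph _ _ R.
- have /asboolP[y [a mE]] := mP.
  have nP : sub_pred (ext_pred_submodule x0 iota' w') (F m.1, m.2).
    apply/asboolP; exists (b y), a; rewrite mE /= addrC FP Fi Fw.
    by rewrite addrC.
  by exists (exist (sub_pred (ext_pred_submodule x0 iota' w')) _ nP).
- by rewrite /R !sval_linear => -> ->; rewrite /= FP.
- by move=> h; apply: val_inj; rewrite [LHS]h /= F0.
exists f; split=> [y|m]; last by rewrite /= /ext_prj fR.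
by apply: fU; rewrite /R /= Fi.
Qed.
End CyclicExtensionMap.
End Extensions.

(** * Linear families of extensions and their Baer sums *)

Section ExtSpace.
Variables (K : fieldType) (A : algType K).
Variables (X Y W : lmodType A) (x0 : X) (iota : {linear Y -> W}) (w : W).
Hypotheses (cyc : forall x, exists a, x = a *: x0) (iotaI : injective iota)
  (hw : forall a : A, a *: x0 = 0 -> exists y, a *: w = iota y).

Lemma ann_scale (c : K) (a : A) : a *: x0 = 0 -> exists y, a *: (c *| w) = iota y.
Proof.
by move=> /hw[y e]; exists (c *| y); rewrite ksc_comm e linearZ_LR.
Qed.

Lemma ann_pair (c d : K) (a : A) : a *: x0 = 0 ->
  exists y, a *: ((c *| w, d *| w) : W * W) = prod_map iota iota y.
Proof.
move=> a0; have [y ey] := ann_scale c a0; have [y' ey'] := ann_scale d a0.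
by exists (y, y'); congr pair.
Qed.

Lemma prod_map_inj : injective (prod_map iota iota).
Proof. by move=> [x y] [x' y'] [] /iotaI -> /iotaI ->. Qed.

Definition ext1 c := ext_of cyc iotaI (@ann_scale c).
(** The pullback of [ext1 c] (+) [ext1 d] along the diagonal of X, that is, the intermediate
    extension required by [baer_sum]. *)
Definition ext2 c d := ext_of cyc prod_map_inj (@ann_pair c d).

(** The addition W (+) W -> W sends (c w, d w) to (c + d) w and so maps [ext2 c d] to
    [ext1 (c + d)]; multiplication by a scalar on W gives the scaling of classes. *)
Lemma ext1_dim_of (Cat : lmodType A -> Prop) k (l : 'rV[K]_k -> K) :
  (forall u v, l (u + v) = l u + l v) -> (forall c u, l (c *: u) = c * l u) ->
  (forall c, Cat (mid (ext1 c))) -> (forall c d, Cat (mid (ext2 c d))) ->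
  (forall u v, ext_eq (ext1 (l u)) (ext1 (l v)) -> u = v) ->
  (forall E, Cat (mid E) -> exists u, ext_eq E (ext1 (l u))) ->
  ext1_dim Cat X Y k.
Proof.
move=> lD lZ C1 C2 inj surj; exists (fun u => ext1 (l u)).
split=> [u|]; first exact: C1.
split=> // [u v|c u].
- exists (ext2 (l u) (l v)); split; first exact: C2.
    have [f1 [f1i f1p]] : ext_hom (ext2 (l u) (l v)) (ext1 (l u)) fst id.
      by apply: (ext_of_map _ _ _ _ _ (F := fst)).
    have [f2 [f2i f2p]] : ext_hom (ext2 (l u) (l v)) (ext1 (l v)) snd id.
      by apply: (ext_of_map _ _ _ _ _ (F := snd)).
    pose f m := (f1 m, f2 m).
    have fL : linear f by move=> a m m'; rewrite /f !linearP.
    exists (HB.pack_for {linear mid (ext2 (l u) (l v)) -> (mid (ext1 (l u)) * mid (ext1 (l v)))%type} f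
      (GRing.isLinear.Build A _ _ _ f fL)).
    split=> [y|m]; first by rewrite /= /f f1i f2i.
    by rewrite /= /f /prod_map /= f1p f2p.
  apply: (ext_of_map _ _ _ _ _ (F := fun m => m.1 + m.2)).
  - by move=> a m m'; rewrite /= scalerDr addrACA.
  - by move=> [y y'] /=; rewrite linearD.
  - by rewrite /= lD kscDl.
- apply: (ext_of_map _ _ _ _ _ (F := fun m => c *| m)).
  - by move=> a m m'; rewrite scalerDr ksc_comm.
  - by move=> y; rewrite linearZ_LR.
  - by rewrite kscA lZ.
Qed.

End ExtSpace.

(** * Simple objects *)

Section CategoryN.
Variables (K : numFieldType) (A : algType K) (g : sbasis -> A).
Hypothesis gE : enveloping g.
Implicit Types (M X Y W : lmodType A) (i j : int).
Local Notation wvec := (wvec g).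
Local Notation wt i := (hvee K *~ i).
Local Notation Lg := (Lg g).
Local Notation poly_model := (poly_model g).

Lemma coef_nablaH i (P : {poly K}) l :
  (nabla_fun i Bh P)`_l = (i - l.*2%:Z)%:~R * P`_l.
Proof.
rewrite /= coefB coefCM -mulrA mulr_natl coefMn coefXM coef_deriv.
rewrite rmorphB /= mulrBl; congr (_ - _).
case: l => [|l] /=; first by rewrite mul0rn mul0r.
by rewrite -mulrnA -pmulrn mulr_natl muln2.
Qed.

(** h is diagonal on the monomials, with the distinct eigenvalues i - 2k on X^k. The leading term of
    u v thus fixes the weight and excludes all other terms; weight spaces are at most
    one-dimensional. *)
Lemma pm_weight X i (x0 : X) u (mu : weight K) (v : X) : poly_model i x0 u ->
  wvec mu v -> v != 0 ->
  exists k c, [/\ c != 0, mu = wt (i - k.*2%:Z), (i < 0) || (k <= `|i|)%N &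
    u v = c *: 'X^k].
Proof.
move=> pm /weight_vecP[hv zv] v0.
have P0 := pm_neq0 pm v0; have sP : (0 < size (u v))%N by rewrite size_poly_gt0.
have mu2 : mu.2 = 0.
  have e0 : mu.2 *| v = 0.
    by rewrite -zv; apply: (pm_inj pm); rewrite (pm_gen pm) (pm0 pm).
  by apply/eqP; apply: contraT => h; rewrite (ksc_eq0 e0 h) eqxx in v0.
have hP l : (i - l.*2%:Z)%:~R * (u v)`_l = mu.1 * (u v)`_l.
  by rewrite -coef_nablaH -(pm_gen pm) hv (pmZ pm) coefZ.
pose k := (size (u v)).-1; have ck : (u v)`_k != 0 by rewrite -lead_coefE lead_coef_eq0.
have mu1 : mu.1 = (i - k.*2%:Z)%:~R by apply: (mulIf ck); rewrite hP.
exists k, (u v)`_k; split=> //.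
- by rewrite (hveeE K (i - k.*2%:Z)); case: mu mu1 mu2 {hv zv hP} => a b /= -> ->.
- have := (pm_im gE pm (u v)).2 (ex_intro _ v erefl); rewrite /lrange => /orP[->//|h].
  by apply/orP; right; rewrite /k -ltnS prednK.
- apply/polyP => l; rewrite coefZ coefXn; have [->|lk] := eqVneq l k; first by rewrite mulr1.
  rewrite mulr0; apply/eqP; apply: contraT => cl.
  have := hP l; rewrite mu1 => /(mulIf cl)/eqP; rewrite eqr_int; lia.
Qed.

Lemma pm_weight_wt X i (x0 : X) u m (v : X) : poly_model i x0 u ->
  wvec (wt m) v -> v != 0 ->
  exists k c, [/\ c != 0, m = i - k.*2%:Z, (i < 0) || (k <= `|i|)%N &
    u v = c *: 'X^k].
Proof.
move=> pm hv /(pm_weight pm hv)[k [c [c0 /hvee_inj e h uv]]].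
by exists k, c.
Qed.

Lemma pm_simple X i (x0 : X) u (v : X) : poly_model i x0 u -> v != 0 ->
  exists a : A, a *: v = x0.
Proof.
move=> pm /(pm_neq0 pm) /(nabla_iter_deriv i)[k [c [c0 hk]]].
have e : g Be ^+ k *: v = c *| x0.
  apply: (pm_inj pm); rewrite (pmZ pm) (pm_gen1 pm) alg_polyC -hk.
  elim: k {hk} => [|k IH]; first by rewrite scale1r.
  by rewrite gen_expS (pm_gen pm) IH.
exists (c^-1 *: g Be ^+ k).
by rewrite ksc_scale e kscA mulVf // ksc1.
Qed.

Lemma L_embed Y W j (y0 : Y) u (y' : W) : poly_model j y0 u ->
  (forall a : A, ann_rel g j a -> a *: y' = 0) -> y' != 0 ->
  exists iota : {linear Y -> W}, injective iota /\ iota y0 = y'.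
Proof.
move=> pm hann y'0.
have ann0 (a : A) : a *: y0 = 0 -> a *: y' = 0.
  move=> /(ann_gen gE pm); elim=> [b /hann//||b c d _ hc _ hd]; first by rewrite scale0r.
  by rewrite scalerDl -[b *: c]/(b * c) -scalerA hc hd scaler0 addr0.
pose R y w := exists a : A, y = a *: y0 /\ w = a *: y'.
have [y||w|f [fR fU]] := @linear_graph _ _ _ _ R.
- by have [a ->] := pm_cyc pm y; exists (a *: y'), a.
- move=> b m n m' n' [a [-> ->]] [a' [-> ->]]; exists (b * a + a').
  by rewrite !scalerDl !scalerA.
- by move=> [a [/esym/ann0 -> ->]].
have fy : f y0 = y' by apply: fU; exists 1; rewrite !scale1r.
exists f; split=> // x y h; apply/eqP; rewrite -subr_eq0; apply: contraT => xy.
have [a ha] := pm_simple pm xy; case/eqP: y'0.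
by rewrite -fy -ha linearZ_LR linearB h subrr scaler0.
Qed.

(** The image of x0 is nonzero and killed by e = d/dX, hence a constant, which has weight j. *)
Lemma L_iso_inj X Y i j (x0 : X) u (y0 : Y) u' (f : {linear X -> Y}) : poly_model i x0 u ->
  poly_model j y0 u' -> injective f -> i = j.
Proof.
move=> pm pm' fI; have [hx ex _ _] := pm_hw pm.
have fx0 : f x0 != 0.
  by apply: contraNneq (pm_gen1_neq0 pm) => h; apply/eqP/fI; rewrite h linear0.
have [k [c [c0 -> _ uf]]] := pm_weight_wt pm' (weight_vec_lin f hx) fx0.
have : (c *: 'X^k : {poly K})^`() = 0.
  by rewrite -uf -[LHS]/(nabla_fun j Be _) -(pm_gen pm') -linearZ_LR ex linear0 (pm0 pm').
rewrite derivZ derivXn => /eqP; rewrite scaler_eq0 (negPf c0) /=.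
rewrite -scaler_nat scaler_eq0 pnatr_eq0.
rewrite -size_poly_eq0 size_polyXn orbF => /eqP ->; lia.
Qed.

Lemma loc_fin_singular M (x : M) : g Be *: x = 0 -> g Bp *: x = 0 -> loc_fin g x.
Proof.
move=> ex px; exists [:: x]; split; first by apply: in_span_mem; rewrite mem_head.
by move=> y v hy; rewrite inE => /eqP ->; case: hy => ->; rewrite ?ex ?px; exact: in_span0.
Qed.

Lemma catO_cyclic M (x : M) mu : wvec mu x -> g Be *: x = 0 -> g Bp *: x = 0 ->
  (forall v, exists a : A, v = a *: x) -> catOg g M.
Proof.
move=> hx ex px cyc; apply: (catO_gen gE (s := [:: x])) => v.
  have [a ->] := cyc v; rewrite -[_ *: _]addr0; apply: submod_genP; last exact: submod_gen0.
  by apply: submod_gen_in; rewrite mem_head.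
rewrite inE => /eqP->; split; first by exists mu.
exact: loc_fin_singular.
Qed.

Variable N : int -> Prop.
Hypothesis Ndown : forall m n, m <= n -> N n -> N m.

(** Both categories of the theorem have this form, with N all integers or those at most n. Since N
    is closed downwards, L(i) belongs to the category for every i in N. *)
Definition catN M := catOg g M /\ forall mu, wsupport g M mu -> exists2 m, N m & mu = wt m.

Lemma L_support X i (x0 : X) u mu (v : X) : poly_model i x0 u -> N i -> wvec mu v ->
  v != 0 -> exists2 m, N m & mu = wt m.
Proof.
move=> pm Ni hv /(pm_weight pm hv)[k [c [_ -> _ _]]]; exists (i - k.*2%:Z) => //.
by apply: Ndown Ni; lia.
Qed.

Lemma L_catN X i (x0 : X) u : poly_model i x0 u -> N i -> catN X.
Proof.
move=> pm Ni; have [hx ex px _] := pm_hw pm; split.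
  exact: catO_cyclic hx ex px (pm_cyc pm).
by move=> mu [v [v0 hv]]; exact: L_support pm Ni hv v0.
Qed.

Lemma L_simple X i (x0 : X) u : poly_model i x0 u -> N i -> simple_object catN X.
Proof.
move=> pm Ni; split; first exact: L_catN pm Ni.
  by exists x0; exact: pm_gen1_neq0 pm.
move=> M _ f _; apply: contrapT => /not_orP[h1 h2].
apply: h2 => y; have /existsNP[x /eqP fx] := h1.
have [a ha] := pm_simple pm fx; have [b ->] := pm_cyc pm y.
by exists (b *: (a *: x)); rewrite !linearZ_LR ha.
Qed.

Definition cyclic M (x : M) (v : M) := exists a : A, v = a *: x.

Lemma cyclic_submodule M (x : M) : submodule (cyclic x).
Proof.
split; first by exists 0; rewrite scale0r.
by move=> b _ _ [a ->] [a' ->]; exists (b * a + a'); rewrite scalerDl scalerA.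
Qed.

Lemma cyclic_catN M (x : M) mu : catN M -> wvec mu x -> g Be *: x = 0 ->
  g Bp *: x = 0 -> catN (sub_mod (cyclic_submodule x)).
Proof.
move=> [_ hM] hx ex px; pose S := sub_mod (cyclic_submodule x).
have valI : injective (val : {linear S -> M}) by exact: val_inj.
have xP : sub_pred (cyclic_submodule x) x by apply/asboolP; exists 1; rewrite scale1r.
pose x' : S := exist (sub_pred (cyclic_submodule x)) x xP.
split=> [|nu [v [v0 hv]]].
  apply: (@catO_cyclic S x' mu).
  - by apply: (weight_vec_inj valI); exact: hx.
  - by apply: val_inj; rewrite linearZ_LR linear0; exact: ex.
  - by apply: val_inj; rewrite linearZ_LR linear0; exact: px.
  - move=> [v vP]; have /asboolP[a vE] := vP; exists a; apply: val_inj.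
    by rewrite linearZ_LR.
apply: hM; exists (val v); split; last exact: weight_vec_lin hv.
by apply: contraNneq v0 => h; apply/eqP/val_inj; rewrite h linear0.
Qed.

Lemma cyclic_simple M (x : M) mu : simple_object catN M -> wvec mu x -> x != 0 ->
  g Be *: x = 0 -> g Bp *: x = 0 -> forall v, exists a : A, v = a *: x.
Proof.
move=> [hM _ hS] hx x0 ex px v.
have xP : sub_pred (cyclic_submodule x) x by apply/asboolP; exists 1; rewrite scale1r.
have [h|h] := hS _ (cyclic_catN hM hx ex px) val val_inj.
  by case/eqP: x0; exact: (h (exist (sub_pred (cyclic_submodule x)) x xP)).
by have [[w wP] <-] := h v; have /asboolP[a wE] := wP; exists a.
Qed.

Lemma submodule_full M : submodule (fun _ : M => True).
Proof. by []. Qed.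

(** Simplicity tests only subobjects lying in the category. Submodules are therefore reached through
    a singular vector, whose cyclic submodule does lie there ([cyclic_simple]). This gives a
    generator x of M, and a nonzero kernel of M -> L(i) would contain another generator, although x
    is not in it. *)
Lemma simple_classif M : simple_object catN M -> exists2 i, N i & iso M (Lg (wt i)).
Proof.
move=> hM; have [[hO hsupp] [x1 x10] _] := hM.
have [x [mu [_ x0 hx ex px]]] := exists_singular gE hO (submodule_full M) I x10.
have [|i Ni mui] := hsupp mu; first by exists x.
rewrite {mu}mui in hx; exists i => //.
have cyc := cyclic_simple hM hx x0 ex px.
have [u pm] := L_model gE i.
have [|F FE] := @mod_quot_lift _ _ (vermag_rel g (wt i)) _ (act_on x).
  have [hm zm] := weight_vec_wt hx.
  move=> s; rewrite /= /act_on (hveeE K i) => -[->|->|->|->] //.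
    by rewrite scalerBl hm subrr.
  by rewrite scalerBl zm ksc0 subr0.
pose v0 : Vermag g (wt i) := mod_pi _ 1.
have Fv0 : F v0 = x by rewrite FE /= /act_on scale1r.
have annL (a : A) : a *: x = 0 -> a *: L_gen g (wt i) = 0.
  move=> a0; rewrite -linearZ_LR -[RHS](linear0 (@mod_pi _ _ _)).
  apply/mod_piP; rewrite subr0; apply: submod_gen_in; exists (fun v => F v = 0); split.
  - by split=> [|b c d hc hd]; rewrite ?linear0 // linearP hc hd scaler0 addr0.
  - by exists v0; rewrite Fv0; exact/eqP.
  - by rewrite linearZ_LR Fv0.
pose R v w := exists a : A, v = a *: x /\ w = a *: L_gen g (wt i).
have [v||w|f [fR fU]] := @linear_graph _ _ _ _ R.
- by have [a ->] := cyc v; exists (a *: L_gen g (wt i)), a.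
- move=> b m n m' n' [a [-> ->]] [a' [-> ->]]; exists (b * a + a').
  by rewrite !scalerDl !scalerA.
- by move=> [a [/esym/annL -> ->]].
have fx : f x = L_gen g (wt i) by apply: fU; exists 1; rewrite !scale1r.
have kerf : submodule (fun v => f v = 0).
  by split=> [|b c d hc hd]; rewrite ?linear0 // linearP hc hd scaler0 addr0.
have fI : injective f.
  move=> a b /eqP; rewrite -subr_eq0 -linearB => /eqP h.
  apply/eqP; rewrite -subr_eq0; apply: contraT => ab.
  have [y [mu [fy y0 hy ey py]]] := exists_singular gE hO kerf h ab.
  have [c xE] := cyclic_simple hM hy y0 ey py x.
  have := pm_gen1_neq0 pm; rewrite -fx xE linearZ_LR fy scaler0 eqxx //.
have fS w : exists v, f v = w.
  by have [a ->] := pm_cyc pm w; exists (a *: x); rewrite linearZ_LR fx.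
have [h hK] := choice fS; exists f, h => // v; apply: fI; exact: hK.
Qed.

End CategoryN.

(** * Extensions between simple modules *)

Section Ext1.
Variables (K : numFieldType) (A : algType K) (g : sbasis -> A).
Hypothesis gE : enveloping g.
Implicit Types (M : lmodType A).
Local Notation wvec := (wvec g).
Local Notation wt i := (hvee K *~ i).
Local Notation poly_model := (poly_model g).
Variable N : int -> Prop.
Hypothesis Ndown : forall m n, m <= n -> N n -> N m.
Local Notation catN := (catN g N).

Lemma in_span_lin M (M' : lmodType A) (f : {linear M -> M'}) s v :
  in_span s v -> in_span [seq f x | x <- s] (f v).
Proof.
move: v; apply: in_span_ind => [|c u v hu hv|v vs]; first by rewrite linear0; exact: in_span0.
  by rewrite linearK; apply: in_spanL.
by apply: in_span_mem; apply: map_f.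
Qed.

Lemma loc_fin_lin M (M' : lmodType A) (f : {linear M -> M'}) v :
  loc_fin g v -> loc_fin g (f v).
Proof.
move=> [s [sv hs]]; exists [seq f x | x <- s]; split; first exact: in_span_lin.
move=> x w hx /mapP[w' ws ->]; rewrite -linearZ_LR; apply: in_span_lin; exact: hs.
Qed.

Lemma weight_pair M (M' : lmodType A) mu (u : M) (v : M') :
  wvec mu u -> wvec mu v -> wvec mu ((u, v) : M * M').
Proof.
move=> /weight_vecP[u1 u2] /weight_vecP[v1 v2]; apply/weight_vecP.
by split; congr pair.
Qed.

Lemma gen_linear M (M' : lmodType A) (f : M -> M') :
  (forall c u v, f (c *| u + v) = c *| f u + f v) ->
  (forall x v, f (g x *: v) = g x *: f v) -> linear f.
Proof.
move=> fL fg.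
have fD u v : f (u + v) = f u + f v by have := fL 1 u v; rewrite !ksc1.
have f0 : f 0 = 0 by apply: (addrI (f 0)); rewrite -fD !addr0.
move=> a u v; rewrite fD; congr (_ + _).
elim/(env_ind gE): a => [||c a b ha hb|x a ha].
- by rewrite !scale0r f0.
- by rewrite !scale1r.
- by rewrite !scalerDl !(ksc_scale a) fL ha hb.
- by rewrite -!scalerA fg ha.
Qed.

Variables (X Y : lmodType A) (i j : int) (x0 : X) (y0 : Y).
Variables (u : X -> {poly K}) (v : Y -> {poly K}).
Hypotheses (pmX : poly_model i x0 u) (pmY : poly_model j y0 v) (Ni : N i) (Nj : N j).

(** e m0 and p m0 come from the submodule, which is locally finite. A weight vector of the middle
    term either has nonzero image in X or comes from the submodule, so no new weights appear and the
    truncation is respected. *)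
Lemma catN_ext (Y' : lmodType A) (s : seq Y') (E : extension X Y') m0 :
  (forall y : Y', submod_gen (fun y => y \in s) y) ->
  (forall y : Y', y \in s -> (exists mu, wvec mu y) /\ loc_fin g y) ->
  (forall mu (y : Y'), wvec mu y -> y != 0 -> exists2 m, N m & mu = wt m) ->
  prj E m0 = x0 -> wvec (wt i) m0 -> catN (mid E).
Proof.
move=> sY hs supp pm hm; have [hx ex px _] := pm_hw pmX.
have lfY (y : Y') : loc_fin g y.
  have := sY y; move: y; apply: submod_gen_ind.
  - exact: loc_fin0.
  - by move=> c a b; exact: loc_finL.
  - by move=> a b; exact: (loc_finU gE).
  - by move=> y /hs[].
have lf0 (a : A) : a *: x0 = 0 -> loc_fin g (a *: m0).
  move=> a0; have [|y <-] := (inc_prj_exact (e := E) (a *: m0)).1.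
    by rewrite linearZ_LR pm.
  exact: loc_fin_lin.
split.
  apply: (catO_gen gE (s := m0 :: [seq inc E y | y <- s])) => m.
    have [y [a ->]] := extension_split pm (pm_cyc pmX) m.
    rewrite addrC; apply: submod_genP; first by apply: submod_gen_in; rewrite mem_head.
    have := sY y; move: y; apply: submod_gen_ind.
    + rewrite linear0; exact: submod_gen0.
    + by move=> c b d; rewrite linearK; apply: submod_genP.
    + move=> b y hy; rewrite linearZ_LR -[_ *: _]addr0.
      by apply: submod_genP => //; exact: submod_gen0.
    + by move=> y ys; apply: submod_gen_in; rewrite inE map_f ?orbT.
  rewrite inE => /orP[/eqP->|/mapP[y /hs[[mu hy] ly] ->]]; split.
  - by exists (wt i).
  - by apply: loc_fin_step; apply: lf0.
  - by exists mu; exact: weight_vec_lin.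
  - exact: loc_fin_lin.
move=> mu [m [mn0 hmu]]; have [p0|p0] := eqVneq (prj E m) 0; last first.
  exact: (L_support gE Ndown pmX Ni (weight_vec_lin (prj E) hmu) p0).
have [y yE] := (inc_prj_exact (e := E) m).1 p0.
apply: (supp mu y).
  by apply: (weight_vec_inj (@Defs.inc_inj _ _ _ _ E)); rewrite yE.
by apply: contraNneq mn0 => h; rewrite -yE h linear0.
Qed.

Lemma ann_rel_ext (M : lmodType A) (P : A -> Prop) :
  (forall a : A, ann_rel g i a -> P a) -> P 0 ->
  (forall b a a', P a -> P a' -> P (b * a + a')) ->
  forall a : A, a *: x0 = 0 -> P a.
Proof.
move=> h P0 PL a /(ann_gen gE pmX); elim=> [b /h//|//|b c d _ hc _ hd].
exact: PL.
Qed.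

(** Injectivity in the parameter: as Y has no vectors of weight i, a morphism of extensions must
    match the lifts (c w, x0), and a relation a with a w nonzero recovers c. For surjectivity it
    suffices to compare a lift m0 with c w on the generators of the annihilator. *)
Lemma ext_case (W : lmodType A) (iota : {linear Y -> W}) (w : W) k (l : 'rV[K]_k -> K) :
  (forall u v, l (u + v) = l u + l v) -> (forall c u, l (c *: u) = c * l u) ->
  injective iota -> wvec (wt i) w ->
  (forall a : A, ann_rel g i a -> exists y, a *: w = iota y) ->
  (forall u v : 'rV[K]_k, u = v) \/
    [/\ injective l, forall y : Y, wvec (wt i) y -> y = 0 &
        exists2 a : A, ann_rel g i a & a *: w != 0] ->
  (forall E : extension X Y, catN (mid E) -> exists m0 r, prj E m0 = x0 /\
     forall a : A, ann_rel g i a ->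
       exists y, a *: m0 = inc E y /\ iota y = l r *| (a *: w)) ->
  ext1_dim catN X Y k.
Proof.
move=> lD lZ iotaI hw H Hinj Hsurj.
have cyc := pm_cyc pmX; have [hx _ _ _] := pm_hw pmX.
have hann : forall a : A, a *: x0 = 0 -> exists y, a *: w = iota y.
  apply: (ann_rel_ext Y); [exact: H| |].
    by exists 0; rewrite scale0r linear0.
  move=> b a a' [y ey] [y' ey']; exists (b *: y + y').
  by rewrite scalerDl -scalerA ey ey' linearP.
have [hy0 ey0 py0 _] := pm_hw pmY.
have hgen (Y' W' : lmodType A) (f : {linear Y' -> W'}) (w' : W') : wvec (wt i) w' ->
    wvec (wt i) (ext_gen x0 f w').
  move=> hw'; apply: (weight_vec_inj (f := val : {linear ext_mid x0 f w' -> _})).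
    exact: val_inj.
  exact: weight_pair.
apply: (ext1_dim_of (cyc := cyc) (iotaI := iotaI) (hw := hann) lD lZ).
- move=> c; apply: (@catN_ext Y [:: y0] (ext1 cyc iotaI hann c) (ext_gen x0 iota (c *| w))) => //.
  + move=> y; have [a ->] := pm_cyc pmY y; rewrite -[_ *: _]addr0.
    by apply: submod_genP; [apply: submod_gen_in; rewrite mem_head|exact: submod_gen0].
  + move=> y; rewrite inE => /eqP->; split; first by exists (wt j).
    exact: loc_fin_singular.
  + by move=> mu y; exact: (L_support gE Ndown pmY Nj).
  + exact/hgen/weight_vecZ.
- move=> c d; apply: (@catN_ext (Y * Y)%type [:: (y0, 0); (0, y0)] (ext2 cyc iotaI hann c d)
    (ext_gen x0 (prod_map iota iota) (c *| w, d *| w))) => //.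
  + move=> [y y']; have [[a ->] [b ->]] := (pm_cyc pmY y, pm_cyc pmY y').
    have -> : (a *: y0, b *: y0) = a *: (y0, 0) + (b *: (0, y0) + 0) :> Y * Y.
      by congr pair; rewrite /= !scaler0 ?addr0 ?add0r.
    apply: submod_genP; first by apply: submod_gen_in; rewrite mem_head.
    by apply: submod_genP; [apply: submod_gen_in; rewrite !inE eqxx orbT|exact: submod_gen0].
  + move=> y; rewrite !inE => /orP[] /eqP->; split.
    * by exists (wt j); apply: weight_pair => //; exact: weight_vec0.
    * by apply: loc_fin_singular; congr pair; rewrite /= ?scaler0.
    * by exists (wt j); apply: weight_pair => //; exact: weight_vec0.
    * by apply: loc_fin_singular; congr pair; rewrite /= ?scaler0.
  + move=> mu [y y'] hyy nz.
    have hy : wvec mu y by exact: (weight_vec_lin fst hyy).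
    have hy' : wvec mu y' by exact: (weight_vec_lin snd hyy).
    have [y_0|y_0] := eqVneq y 0; last exact: (L_support gE Ndown pmY Nj hy y_0).
    apply: (L_support gE Ndown pmY Nj hy'); apply: contraNneq nz => y'_0.
    by rewrite y_0 y'_0.
  + by apply: hgen; apply: weight_pair; exact: weight_vecZ.
- move=> r s [f [fi fp]]; case: Hinj => [h|[lI Yi [a ha aw]]]; first exact: h.
  apply: lI.
  set mr := ext_gen x0 iota (l r *| w); set ms := ext_gen x0 iota (l s *| w).
  have e : f mr = ms.
    have [|y yE] := (inc_prj_exact (e := ext1 cyc iotaI hann (l s)) (f mr - ms)).1.
      by rewrite linearB fp subrr.
    apply/eqP; rewrite -subr_eq0 -yE (Yi y) ?linear0 //.
    apply: (weight_vec_inj (@Defs.inc_inj _ _ _ _ (ext1 cyc iotaI hann (l s)))).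
    rewrite yE; apply: weight_vecB; last exact/hgen/weight_vecZ.
    exact/weight_vec_lin/hgen/weight_vecZ.
  have a0 := ann_rel0 pmX ha; have [y yE] := H a ha.
  have gE' c : a *: ext_gen x0 iota (c *| w) = ext_inc x0 iota (c *| w) (c *| y).
    by apply: val_inj; rewrite linearZ_LR; congr pair => //=; rewrite ksc_comm yE linearZ_LR.
  have := congr1 (fun m => a *: m) e; rewrite /= -linearZ_LR !gE'.
  have -> : f (ext_inc x0 iota (l r *| w) (l r *| y)) = inc (ext1 cyc iotaI hann (l s)) (l r *| y).
    exact: fi.
  move/(@Defs.inc_inj _ _ _ _ (ext1 cyc iotaI hann (l s)))/eqP.
  rewrite -subr_eq0 -kscBl => /eqP h; apply/eqP; rewrite -subr_eq0; apply: contraT => h'.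
  by case/eqP: aw; rewrite yE (ksc_eq0 h h') linear0.
- move=> E /Hsurj[m0 [r [pm hm]]]; exists r.
  apply: (@ext_eq_cyclic _ _ _ _ E (ext1 cyc iotaI hann (l r)) x0 m0
    (ext_gen x0 iota (l r *| w)) cyc) => //.
  move=> a a0.
  suff [y [ay iy]] : exists y, a *: m0 = inc E y /\ iota y = l r *| (a *: w).
    exists y; split=> //; apply: val_inj; rewrite linearZ_LR; congr pair => //=.
    by rewrite ksc_comm iy.
  move: a a0; apply: (ann_rel_ext Y); first exact: hm.
    by exists 0; rewrite !scale0r !linear0 scaler0.
  move=> b a a' [y [ay iy]] [y' [ay' iy']]; exists (b *: y + y').
  by rewrite !scalerDl -!scalerA ay ay' !linearP iy iy' /= scalerDr -(ksc_comm b).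
Qed.

End Ext1.

(** * Computing in a module through a linear model *)

Section LinearModel.
Variables (K : numFieldType) (A : algType K) (g : sbasis -> A).
Hypothesis gE : enveloping g.
Variables (V : lmodType K) (op : sbasis -> {linear V -> V}) (W : lmodType A).
Variable psi : W -> V.
Hypotheses (psiI : injective psi) (psiS : forall v, exists m, psi m = v)
  (psiL : forall c u v, psi (c *| u + v) = c *: psi u + psi v)
  (psig : forall x m, psi (g x *: m) = op x (psi m)).

Lemma model0 : psi 0 = 0.
Proof. by have := psiL (-1) 0 0; rewrite scaler0 addr0 scaleN1r addNr. Qed.

Lemma modelZ c w : psi (c *| w) = c *: psi w.
Proof. by rewrite -[_ *: _]addr0 psiL model0 addr0. Qed.

Lemma model_eq0 w : psi w = 0 -> w = 0.
Proof. by move=> h; apply: psiI; rewrite model0. Qed.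

Lemma model_weight (m : int) w : op Bh (psi w) = m%:~R *: psi w -> op Bz (psi w) = 0 ->
  wvec g (hvee K *~ m) w.
Proof.
move=> hh hz; apply/weight_vecP; rewrite (hveeE K m) /= ksc0; split; apply: (psiI).
  by rewrite psig modelZ.
by rewrite psig model0.
Qed.

Lemma model_embed (Y : lmodType A) (t : Y -> V) :
  (forall c y y', t (c *| y + y') = c *: t y + t y') ->
  (forall x y, t (g x *: y) = op x (t y)) ->
  exists iota : {linear Y -> W}, forall y, psi (iota y) = t y.
Proof.
move=> tL tg; have [f fE] := choice (fun y => psiS (t y)).
have fL : linear f.
  apply: (gen_linear gE) => [c y y'|x y]; apply: (psiI).
    by rewrite psiL !fE tL.
  by rewrite psig !fE tg.
by exists (HB.pack_for {linear Y -> W} f (GRing.isLinear.Build A Y W _ f fL)).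
Qed.

End LinearModel.

(** * Ext^1 between simple modules, case by case *)

Section Ext1Cases.
Variables (K : numFieldType) (A : algType K) (g : sbasis -> A).
Hypothesis gE : enveloping g.
Local Notation wvec := (wvec g).
Local Notation wt i := (hvee K *~ i).
Local Notation poly_model := (poly_model g).
Variable N : int -> Prop.
Hypothesis Ndown : forall m n, m <= n -> N n -> N m.
Local Notation catN := (catN g N).
Variables (X Y : lmodType A) (i j : int) (x0 : X) (y0 : Y).
Variables (u : X -> {poly K}) (v : Y -> {poly K}).
Hypotheses (pmX : poly_model i x0 u) (pmY : poly_model j y0 v) (Ni : N i) (Nj : N j).

Lemma ann_rel_case (P : A -> Prop) : P (g Be) -> P (g Bp) -> P (g Bq) ->
  P (g Bh - (i%:~R : K)%:A) -> P (g Bz - (0 : K)%:A) ->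
  (0 <= i -> P (g Bf ^+ `|i|.+1)) -> forall a : A, ann_rel g i a -> P a.
Proof.
move=> he hp hq hh hz hf a [[->|->|->|->]|->|[/hf ? ->]] //;
  by rewrite (hveeE K i).
Qed.

Lemma wt_cartan (M : lmodType A) (m : M) : wvec (wt i) m ->
  (g Bh - (i%:~R : K)%:A) *: m = 0 /\ (g Bz - (0 : K)%:A) *: m = 0.
Proof.
by move=> /weight_vec_wt[h z]; rewrite !scalerBl h z ksc0 !subrr.
Qed.

Lemma pm_form (k : nat) (y : Y) : wvec (wt (j - k.*2%:Z)) y ->
  exists c, v y = c *: 'X^k.
Proof.
move=> hy; have [->|y_0] := eqVneq y 0; first by exists 0; rewrite (pm0 pmY) scale0r.
have [l [c [_ e _ ->]]] := pm_weight_wt gE pmY hy y_0; exists c.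
by have -> : l = k by lia.
Qed.

Lemma pm_zero m (y : Y) : wvec (wt m) y ->
  (forall k : nat, (j < 0) || (k <= `|j|)%N -> m <> j - k.*2%:Z) -> y = 0.
Proof.
move=> hy hm; apply/eqP; apply: contraT => y_0.
by have [l [c [_ e /hm /(_ e)]]] := pm_weight_wt gE pmY hy y_0.
Qed.

Lemma pm_singular m (y : Y) : wvec (wt m) y -> g Be *: y = 0 -> m <> j -> y = 0.
Proof.
move=> hy ey mj; apply/eqP; apply: contraT => y_0.
have [l [c [c0 e _ vy]]] := pm_weight_wt gE pmY hy y_0.
have : (c *: 'X^l : {poly K})^`() = 0.
  by rewrite -vy -[LHS]/(nabla_fun j Be _) -(pm_gen pmY) ey (pm0 pmY).
rewrite derivZ derivXn -scaler_nat => /eqP.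
rewrite !scaler_eq0 (negPf c0) pnatr_eq0 -size_poly_eq0 size_polyXn orbF /= => /eqP l0.
by move: e; rewrite l0; lia.
Qed.

Lemma gen_e_exp (M : lmodType A) (m : M) k : wvec (wt i) m -> g Be *: m = 0 ->
  g Be *: (g Bf ^+ k.+1 *: m) = (k.+1%:R * (i%:~R - k%:R)) *| (g Bf ^+ k *: m).
Proof.
move=> hm em; have hh l := (weight_vec_wt (hw_weight gE hm l)).1.
elim: k => [|k IH]; rewrite gen_expS (gen_swap gE) /= scale0r subr0 hh.
  by rewrite !scale1r em scaler0 add0r mul1r !subr0.
rewrite IH ksc_comm -gen_expS -kscDl; congr (_ *| _).
rewrite rmorphB /= -pmulrn -muln2 natrM; ring.
Qed.

Section Lift.
Variables (E : extension X Y) (m0 : mid E).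
Hypotheses (pm : prj E m0 = x0) (hm : wvec (wt i) m0).

Lemma lift_gen x : g x *: x0 = 0 ->
  exists2 y, g x *: m0 = inc E y & wvec (wt (i + gen_weight x)) y.
Proof.
move=> gx; have [|y yE] := (inc_prj_exact (e := E) (g x *: m0)).1.
  by rewrite linearZ_LR pm.
exists y => //; apply: (weight_vec_inj (@Defs.inc_inj _ _ _ _ E)).
by rewrite yE; apply: (weight_gen_wt gE).
Qed.

Lemma lift_exp : 0 <= i ->
  exists2 y, g Bf ^+ `|i|.+1 *: m0 = inc E y & wvec (wt (- i - 2)) y.
Proof.
move=> i0; have [|y yE] := (inc_prj_exact (e := E) (g Bf ^+ `|i|.+1 *: m0)).1.
  by rewrite linearZ_LR pm (pm_expf0 pmX).
exists y => //; apply: (weight_vec_inj (@Defs.inc_inj _ _ _ _ E)).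
have -> : - i - 2 = i - (`|i|.+1).*2%:Z by lia.
by rewrite yE; exact: (hw_weight gE hm).
Qed.

End Lift.

Lemma lift_exists (E : extension X Y) : catN (mid E) ->
  exists2 m0, prj E m0 = x0 & wvec (wt i) m0.
Proof.
move=> [[_ hM _] _]; have [hx _ _ _] := pm_hw pmX.
exact: (weight_lift hM (prj_surj E) hx).
Qed.

Let row1 (r : 'rV[K]_1) : K := r 0 0.
Lemma row1D (r s : 'rV[K]_1) : row1 (r + s) = row1 r + row1 s.
Proof. by rewrite /row1 mxE. Qed.
Lemma row1Z c (r : 'rV[K]_1) : row1 (c *: r) = c * row1 r.
Proof. by rewrite /row1 mxE. Qed.
Lemma row1I : injective row1.
Proof. by move=> r s h; apply/rowP => k; rewrite (ord1 k). Qed.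
Lemma row1_const c : row1 (const_mx c) = c.
Proof. by rewrite /row1 mxE. Qed.

(** Here w = (1, 0). Only p and q lead out of the first summand, so e w and, for i >= 0, f^(i+1) w
    vanish as in L(i), and the extension is carried by p w and q w. *)
Lemma pair_module up : j = cross_weight up i ->
  exists (W : lmodType A) (psi : W -> {poly K} * {poly K}) (iota : {linear Y -> W}) (w : W),
    [/\ forall y, psi (iota y) = (0, v y), injective psi &
        forall c a, psi (c *| a) = c *: psi a] /\
    [/\ wvec (wt i) w, g Be *: w = 0, 0 <= i -> g Bf ^+ `|i|.+1 *: w = 0,
        psi (g Bp *: w) = (0, cross_fun up i Bp 1) &
        psi (g Bq *: w) = (0, cross_fun up i Bq 1)].
Proof.
move=> ji; have [W [psi [psiI psiS psiL psig]]] := env_module gE (pair_rel up i).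
have psiZ := modelZ psiL; have psi_0 := model_eq0 psiI psiL.
have [w w1] := psiS (1, 0).
have [iota iotaE] : exists iota : {linear Y -> W}, forall y, psi (iota y) = (0, v y).
  apply: (model_embed gE psiI psiS psiL psig).
    by move=> c y y'; rewrite (pm_lin pmY); congr pair; rewrite /= scaler0 addr0.
  move=> x y; rewrite (pm_gen pmY) /= /pair_fun /= linear0 -ji; congr pair.
  by case: x; case: (up); rewrite /= ?(linear0, mulr0, subrr, addr0).
have fw k : psi (g Bf ^+ k *: w) = (fcoef K i k *: 'X^k, 0).
  elim: k => [|k IH]; first by rewrite scale1r w1 /fcoef big_ord0 scale1r.
  rewrite gen_expS psig IH /= /pair_fun /fcoef big_ord_recr /= -nabla_fX; congr pair.
  by rewrite /= linear0 !mulr0 subr0 addr0.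
exists W, psi, iota, w; split=> //; split.
- apply: (model_weight psiI psiL psig); rewrite w1 /= /pair_fun /=; congr pair;
    by rewrite /= ?derivE ?mulr0 ?subr0 ?addr0 ?scaler0 ?mul_polyC.
- by apply: psi_0; rewrite psig w1 /= /pair_fun /=; congr pair; rewrite ?derivE ?addr0.
- by move=> i0; apply: psi_0; rewrite fw fcoef_eq0 // scale0r.
- by rewrite psig w1 /= /pair_fun /= add0r.
- by rewrite psig w1 /= /pair_fun /= add0r.
Qed.

(** The scalar is the coefficient b in q m0 = b X. The vectors e m0 and f^(i+1) m0 vanish because
    their weights do not occur in L(j), the first being above j and the second of the wrong
    parity. *)
Lemma ext1_up : j = i + 1 -> i != -1 -> ext1_dim catN X Y 1.
Proof.
move=> ji i1; have [hx ex px qx] := pm_hw pmX.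
have [W [psi [iota [w [[iotaE psiI psiZ] [hw ew fw0 pw qw]]]]]] :=
  @pair_module true ji.
rewrite /= mulr1 in pw qw.
have iotaI : injective iota.
  by move=> y y' /(congr1 psi); rewrite !iotaE => -[] /(pm_inj pmY).
have [hh hz] := wt_cartan hw.
(* X lies in the image of L(j) except for j = 0, the case excluded by i != -1. *)
have [yX yXE] : exists y, v y = 'X.
  by apply/(pm_im gE pmY); rewrite /lrange size_polyX; lia.
apply: (ext_case gE Ndown pmX pmY Ni Nj row1D row1Z iotaI hw).
- apply: ann_rel_case; rewrite ?ew ?hh ?hz; try by exists 0; rewrite linear0.
  + by exists y0; apply: psiI; rewrite pw iotaE (pm_gen1 pmY).
  + by exists yX; apply: psiI; rewrite qw iotaE yXE.
  + by move=> /fw0 ->; exists 0; rewrite linear0.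
- right; split; first exact: row1I.
    by move=> y hy; apply: (pm_zero hy); lia.
  exists (g Bq); first exact: Or32.
  apply/eqP => h; have := qw; rewrite h -[0](ksc0 w) psiZ scale0r => -[] /eqP.
  by rewrite eq_sym polyX_eq0.
move=> E /lift_exists[m0 pm hm].
have [ye yeE hye] := lift_gen pm hm ex; have [yp ypE hyp] := lift_gen pm hm px.
have [yq yqE hyq] := lift_gen pm hm qx.
have ye0 : ye = 0 by apply: (pm_zero hye) => /= k _; lia.
have [b yqX] : exists b, v yq = b *: 'X^1.
  by apply: pm_form; move: hyq; congr wvec; congr (_ *~ _) => /=; lia.
exists m0, (const_mx b); split=> //; rewrite row1_const.
(* Since [e, q] = p and e m0 = 0, the vector q m0 determines p m0. *)
have eyq : g Be *: yq = yp.
  apply: (@Defs.inc_inj _ _ _ _ E); rewrite linearZ_LR -yqE (gen_swap gE) yeE ye0 linear0 /=.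
  by rewrite scaler0 add0r scale0r subr0.
have [mh mz] := wt_cartan hm.
apply: ann_rel_case; rewrite ?ew ?hh ?hz ?mh ?mz ?scaler0;
  try by exists 0; rewrite ?yeE ?ye0 !linear0.
- exists yp; split=> //; apply: psiI; rewrite iotaE psiZ pw -eyq (pm_gen pmY) yqX.
  by congr pair; rewrite /= ?scaler0 // derivZ derivX.
- by exists yq; split=> //; apply: psiI; rewrite iotaE psiZ qw yqX; congr pair; rewrite /= scaler0.
- move=> i0; have [yf yfE hyf] := lift_exp pm hm i0.
  have yf0 : yf = 0 by apply: (pm_zero hyf) => /= k _; lia.
  by exists 0; rewrite yfE yf0 fw0 // scaler0 !linear0.
Qed.

(** The model has q w = - i y0, so an extension with q m0 = b y0 has parameter - b / i. At i = 0 the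
    vector q w vanishes and the model gives nothing. *)
Lemma ext1_down : j = i - 1 -> i != 0 -> ext1_dim catN X Y 1.
Proof.
move=> ji i0; have [hx ex px qx] := pm_hw pmX.
have [W [psi [iota [w [[iotaE psiI psiZ] [hw ew fw0 pw qw]]]]]] :=
  @pair_module false ji.
have psi0 : psi 0 = (0, 0) by rewrite -[0](ksc0 w) psiZ scale0r.
have pw0 : g Bp *: w = 0 by apply: psiI; rewrite pw psi0 /= derivE.
have {}qw : psi (g Bq *: w) = (0, (- i%:~R) *: 1).
  by rewrite qw /= derivE mulr0 mulr1 sub0r scaleNr alg_polyC.
have iK : i%:~R != 0 :> K by rewrite intr_eq0.
have iotaI : injective iota.
  by move=> y y' /(congr1 psi); rewrite !iotaE => -[] /(pm_inj pmY).
have [hh hz] := wt_cartan hw.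
apply: (ext_case gE Ndown pmX pmY Ni Nj row1D row1Z iotaI hw).
- apply: ann_rel_case; rewrite ?ew ?pw0 ?hh ?hz; try by exists 0; rewrite linear0.
  + by exists ((- i%:~R) *| y0); apply: psiI; rewrite qw iotaE (pmZ pmY) (pm_gen1 pmY).
  + by move=> /fw0 ->; exists 0; rewrite linear0.
- right; split; first exact: row1I.
    by move=> y hy; apply: (pm_zero hy); lia.
  exists (g Bq); first exact: Or32.
  apply/eqP => h; have := qw; rewrite h psi0 => -[] /eqP.
  by rewrite eq_sym scaler_eq0 oppr_eq0 (negPf iK) oner_eq0.
move=> E /lift_exists[m0 pm hm].
have [ye yeE hye] := lift_gen pm hm ex; have [yp ypE hyp] := lift_gen pm hm px.
have [yq yqE hyq] := lift_gen pm hm qx.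
have ye0 : ye = 0 by apply: (pm_zero hye) => /= k _; lia.
have yp0 : yp = 0 by apply: (pm_zero hyp) => /= k _; lia.
have [b yqX] : exists b, v yq = b *: 'X^0.
  by apply: pm_form; move: hyq; congr wvec; congr (_ *~ _) => /=; lia.
exists m0, (const_mx (- b / i%:~R)); split=> //; rewrite row1_const.
have [mh mz] := wt_cartan hm.
apply: ann_rel_case; rewrite ?ew ?pw0 ?hh ?hz ?mh ?mz ?scaler0;
  try by exists 0; rewrite ?yeE ?ye0 ?ypE ?yp0 !linear0.
- exists yq; split=> //; apply: psiI; rewrite iotaE psiZ qw yqX; congr pair.
    by rewrite /= scaler0.
  by rewrite /= scalerA mulrN !mulNr opprK divfK // expr0.
- move=> i1; have [yf yfE hyf] := lift_exp pm hm i1.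
  have yf0 : yf = 0 by apply: (pm_zero hyf) => /= k _; lia.
  by exists 0; rewrite yfE yf0 fw0 // scaler0 !linear0.
Qed.

(** f^(i+1) w is singular of weight j, so L(j) embeds in the Verma module. The weights i + 2, i + 1
    and i - 1 of e m0, p m0 and q m0 exceed j, which leaves f^(i+1) m0 as the only parameter. *)
Lemma ext1_verma : 0 <= i -> j = - i - 2 -> ext1_dim catN X Y 1.
Proof.
move=> i0 ji; have [hx ex px qx] := pm_hw pmX.
have [W [psi [psiI psiS psiL psig]]] := env_module gE (verma_rel_fun i).
have psi_0 := model_eq0 psiI psiL.
have [w w1] := psiS 1.
have hw : wvec (wt i) w.
  apply: (model_weight psiI psiL psig); rewrite w1 //=.
  by rewrite derivE mulr0 subr0 mul_polyC.
have ew : g Be *: w = 0.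
  by apply: psi_0; rewrite psig w1 /= !derivE !mulr0 subr0.
have pw : g Bp *: w = 0 by apply: psi_0; rewrite psig w1.
have qw : g Bq *: w = 0 by apply: psi_0; rewrite psig w1.
have fw k : psi (g Bf ^+ k *: w) = 'X^k.
  elim: k => [|k IH]; first by rewrite scale1r w1.
  by rewrite gen_expS psig IH /= exprS.
pose y' := g Bf ^+ `|i|.+1 *: w.
have y'0 : y' != 0.
  by apply/eqP => h; have := fw `|i|.+1; rewrite -/y' h (model0 psiL) => /eqP;
    rewrite eq_sym -size_poly_eq0 size_polyXn.
have hy' : wvec (wt j) y'.
  have -> : j = i - (`|i|.+1).*2%:Z by lia.
  exact: (hw_weight gE hw).
have iE : i%:~R = `|i|%:R :> K by rewrite -[in LHS](gez0_abs i0).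
have ey' : g Be *: y' = 0.
  apply: psi_0; rewrite psig fw /= derivXn /= derivMn derivXn iE polyC_natr.
  case: (`|i|)%N => [|n]; first by rewrite mul0r mulr0n mul0rn mulr0 subr0.
  by rewrite /= mulrnAr mulr_natl -mulrnA mulrnAr mulrnAr -exprS -mulrnA mulnC subrr.
have [iota [iotaI iota0]] : exists iota : {linear Y -> W}, injective iota /\ iota y0 = y'.
  apply: (L_embed gE pmY) => // a.
  have [hh hz] := weight_vec_wt hy'.
  case=> [[->|->|->|->]|->|[j0 _]] //; last by lia.
  - exact: (hw_p gE pw qw).
  - by rewrite (hveeE K j) scalerBl hh subrr.
  - by rewrite scalerBl hz (hveeE K j) ksc0 subrr.
  - exact: (hw_q gE qw).
have [hh hz] := wt_cartan hw.
apply: (ext_case gE Ndown pmX pmY Ni Nj row1D row1Z iotaI hw).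
- apply: ann_rel_case; rewrite ?ew ?pw ?qw ?hh ?hz; try by exists 0; rewrite linear0.
  by exists y0; rewrite iota0.
- right; split; first exact: row1I.
    by move=> y hy; apply: (pm_zero hy); lia.
  by exists (g Bf ^+ `|i|.+1) => //; apply: Or33.
move=> E /lift_exists[m0 pm hm].
have [ye yeE hye] := lift_gen pm hm ex; have [yp ypE hyp] := lift_gen pm hm px.
have [yq yqE hyq] := lift_gen pm hm qx; have [yf yfE hyf] := lift_exp pm hm i0.
have ye0 : ye = 0 by apply: (pm_zero hye) => /= k _; lia.
have yp0 : yp = 0 by apply: (pm_zero hyp) => /= k _; lia.
have yq0 : yq = 0 by apply: (pm_zero hyq) => /= k _; lia.
have [b yfX] : exists b, v yf = b *: 'X^0.
  by apply: pm_form; move: hyf; congr wvec; congr (_ *~ _) => /=; lia.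
have yfE' : yf = b *| y0.
  by apply: (pm_inj pmY); rewrite yfX (pmZ pmY) (pm_gen1 pmY).
exists m0, (const_mx b); split=> //; rewrite row1_const.
have [mh mz] := wt_cartan hm.
apply: ann_rel_case; rewrite ?ew ?pw ?qw ?hh ?hz ?mh ?mz ?scaler0;
  try by exists 0; rewrite ?yeE ?ye0 ?ypE ?yp0 ?yqE ?yq0 !linear0.
by exists yf; split=> //; rewrite yfE' linearZ_LR iota0.
Qed.

(** w = X^(j+1) is the first monomial outside L(j), and e w = (j + 1) X^j, the origin of the divisor
    j + 1. The lowest weight of L(j) is - j = i + 2, so only e m0 can be nonzero. *)
Lemma ext1_nabla : 0 <= j -> i = - j - 2 -> ext1_dim catN X Y 1.
Proof.
move=> j0 ij; have [hx ex px qx] := pm_hw pmX.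
have [W [psi [psiI psiS psiL psig]]] := env_module gE (nabla_rel j).
have psi_0 := model_eq0 psiI psiL; have psiZ := modelZ psiL.
have [w w1] := psiS 'X^(`|j|.+1).
have [iota iotaE] : exists iota : {linear Y -> W}, forall y, psi (iota y) = v y.
  apply: (model_embed gE psiI psiS psiL psig); first exact: (pm_lin pmY).
  by move=> x y; rewrite (pm_gen pmY).
have iotaI : injective iota.
  by move=> y y' /(congr1 psi); rewrite !iotaE => /(pm_inj pmY).
have hw : wvec (wt i) w.
  apply: (model_weight psiI psiL psig); rewrite w1 //.
  apply/polyP => l; rewrite [LHS]coef_nablaH coefZ coefXn.
  case: eqP => [->|_]; last by rewrite !mulr0.
  by congr (_%:~R * _); lia.
have ew : psi (g Be *: w) = `|j|.+1%:R *: 'X^(`|j|).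
  by rewrite psig w1 /= derivXn scaler_nat.
have pw : g Bp *: w = 0 by apply: psi_0; rewrite psig w1.
have qw : g Bq *: w = 0 by apply: psi_0; rewrite psig w1.
have nK : `|j|.+1%:R != 0 :> K by rewrite pnatr_eq0.
have [hh hz] := wt_cartan hw.
apply: (ext_case gE Ndown pmX pmY Ni Nj row1D row1Z iotaI hw).
- apply: ann_rel_case; rewrite ?pw ?qw ?hh ?hz; try by exists 0; rewrite linear0.
    have [|y yE] := (pm_im gE pmY (`|j|.+1%:R *: 'X^(`|j|))).1.
      by apply/orP; right; rewrite (leq_trans (size_scale_leq _ _)) // size_polyXn.
    by exists y; apply: psiI; rewrite ew iotaE.
  by move=> i0; lia.
- right; split; first exact: row1I.
    by move=> y hy; apply: (pm_zero hy); lia.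
  exists (g Be); first exact/Or31/Or41.
  apply/eqP => h; have := ew; rewrite h (model0 psiL) => /esym/eqP.
  by rewrite scaler_eq0 (negPf nK) -size_poly_eq0 size_polyXn.
move=> E /lift_exists[m0 pm hm].
have [ye yeE hye] := lift_gen pm hm ex; have [yp ypE hyp] := lift_gen pm hm px.
have [yq yqE hyq] := lift_gen pm hm qx.
have yp0 : yp = 0 by apply: (pm_zero hyp) => /= k _; lia.
have yq0 : yq = 0 by apply: (pm_zero hyq) => /= k _; lia.
have [b yeX] : exists b, v ye = b *: 'X^(`|j|).
  by apply: pm_form; move: hye; congr wvec; congr (_ *~ _) => /=; lia.
exists m0, (const_mx (b / `|j|.+1%:R)); split=> //; rewrite row1_const.
have [mh mz] := wt_cartan hm.
apply: ann_rel_case; rewrite ?pw ?qw ?hh ?hz ?mh ?mz ?scaler0;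
  try by exists 0; rewrite ?ypE ?yp0 ?yqE ?yq0 !linear0.
- by exists ye; split=> //; apply: psiI; rewrite iotaE psiZ ew yeX scalerA divfK.
- by move=> i0; lia.
Qed.

(** The aim is a lift of x0 killed by the whole annihilator. By parity of j - i, either p m0 and q
    m0 vanish, or e m0 and f^(i+1) m0 do. *)
Lemma ext1_split : ~~ ((j == i + 1) && (i != -1)) -> ~~ ((j == i - 1) && (i != 0)) ->
  ~~ ((0 <= i) && (j == - i - 2)) -> ~~ ((0 <= j) && (i == - j - 2)) ->
  ext1_dim catN X Y 0.
Proof.
move=> n1 n2 n3 n4; have [hx ex px qx] := pm_hw pmX.
apply: (ext_case gE Ndown pmX pmY Ni Nj (iota := idfun) (w := 0) (l := fun=> 0)).
- by move=> ? ?; rewrite addr0.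
- by move=> ? ?; rewrite mulr0.
- by [].
- exact: weight_vec0.
- by move=> a _; exists 0; rewrite scaler0.
- by left=> r s; apply/rowP => -[].
move=> E /lift_exists[m1 pm1 hm1].
suff [m0 [[pm hm e0 p0 q0] f0]] : exists m0, [/\ prj E m0 = x0, wvec (wt i) m0,
    g Be *: m0 = 0, g Bp *: m0 = 0 & g Bq *: m0 = 0] /\
    (0 <= i -> g Bf ^+ `|i|.+1 *: m0 = 0).
  have [mh mz] := wt_cartan hm.
  exists m0, (0 : 'rV[K]_0); split=> //; apply: ann_rel_case; rewrite ?e0 ?p0 ?q0 ?mh ?mz;
    try by exists 0; rewrite linear0 ksc0.
  by move=> /f0->; exists 0; rewrite linear0 ksc0.
have [t ht] : exists t : int, j = i + t * 2 \/ j = i + t * 2 + 1.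
  by clear; exists ((j - i) %/ 2)%Z; lia.
case: ht => ht.
  have [m0 [pm hm e0]] : exists m0, [/\ prj E m0 = x0, wvec (wt i) m0 & g Be *: m0 = 0].
    have [ye yeE hye] := lift_gen pm1 hm1 ex.
    have [ye0|ye0] := eqVneq ye 0; first by exists m1; rewrite yeE ye0 linear0.
    have [k [c [c0 /= ik kj vye]]] := pm_weight_wt gE pmY hye ye0.
    (* The lift is corrected by the antiderivative of e m1 = c X^k. It stays in L(j) unless j >= 0
       and k = j, that is i = - j - 2, an excluded arrow. *)
    have [|y vy] := (pm_im gE pmY ((c / k.+1%:R) *: 'X^(k.+1))).1.
      rewrite /lrange; have [//|j0] := ltrP j 0; rewrite (leq_trans (size_scale_leq _ _)) //.
      by rewrite size_polyXn; lia.
    have hy : wvec (wt i) y.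
      apply: (model_weight (pm_inj pmY) (pm_lin pmY) (pm_gen pmY)); rewrite vy //.
      apply/polyP => l; rewrite [LHS]coef_nablaH !coefZ coefXn.
      case: eqP => [->|_]; last by rewrite !mulr0.
      by congr (_%:~R * _); lia.
    exists (m1 - inc E y); split.
    - by rewrite linearB pm1 (_ : prj E _ = 0) ?subr0 //; apply/inc_prj_exact; exists y.
    - by apply: weight_vecB => //; exact: weight_vec_lin.
    - rewrite scalerBr yeE -linearZ_LR -linearB.
      suff -> : ye - g Be *: y = 0 by rewrite linear0.
      apply/eqP; rewrite subr_eq0; apply/eqP/(pm_inj pmY).
      rewrite (pm_gen pmY) vy vye /= derivZ derivXn -scaler_nat scalerA divfK //.
      by rewrite pnatr_eq0.
  have [yp ypE hyp] := lift_gen pm hm px; have [yq yqE hyq] := lift_gen pm hm qx.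
  have yp0 : yp = 0 by apply: (pm_zero hyp) => /= k _; lia.
  have yq0 : yq = 0 by apply: (pm_zero hyq) => /= k _; lia.
  exists m0; split; first by rewrite ypE yp0 yqE yq0 linear0.
  move=> i0; have [yf yfE hyf] := lift_exp pm hm i0; rewrite yfE.
  suff -> : yf = 0 by rewrite linear0.
  (* e f^(i+1) m0 is a multiple of i - i = 0, so f^(i+1) m0 is singular of weight - i - 2, which is
     not j. *)
  apply: (pm_singular hyf); last by lia.
  apply: (@Defs.inc_inj _ _ _ _ E); rewrite linear0 linearZ_LR -yfE.
  by rewrite (gen_e_exp _ hm e0) -[X in X%:~R - _]gez0_abs // subrr mulr0 ksc0.
have [ye yeE hye] := lift_gen pm1 hm1 ex; have [yp ypE hyp] := lift_gen pm1 hm1 px.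
have [yq yqE hyq] := lift_gen pm1 hm1 qx.
have ye0 : ye = 0 by apply: (pm_zero hye) => /= k _; lia.
have f0 : 0 <= i -> g Bf ^+ `|i|.+1 *: m1 = 0.
  move=> i0; have [yf -> hyf] := lift_exp pm1 hm1 i0.
  by rewrite (pm_zero hyf) ?linear0 //= => k _; lia.
have e0 : g Be *: m1 = 0 by rewrite yeE ye0 linear0.
have eyq : g Be *: yq = yp.
  apply: (@Defs.inc_inj _ _ _ _ E); rewrite linearZ_LR -yqE (gen_swap gE) e0 /=.
  by rewrite scaler0 add0r scale0r subr0.
have eyp : g Be *: yp = 0.
  apply: (@Defs.inc_inj _ _ _ _ E); rewrite linearZ_LR -ypE (gen_swap gE) e0 /= linear0.
  by rewrite scaler0 subrr addr0.
suff [yp0 yq0] : yp = 0 /\ yq = 0 by exists m1; rewrite ypE yp0 yqE yq0 linear0.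
(* p m1 = e q m1 is singular, so it can survive only in weight j = i + 1. Then i = -1 and j = 0, and
   q m1 has weight -2, absent from L(0). *)
have [ij|ij] := eqVneq (i + 1) j.
  suff yq0 : yq = 0 by rewrite -eyq yq0 scaler0.
  by apply: (pm_zero hyq) => /= k; lia.
have yp0 : yp = 0 by apply: (pm_singular hyp) => //=; lia.
(* Now q m1 is singular and survives only if j = i - 1. Then i = 0, where f m1 = 0, and q = [f, p]
   kills m1. *)
split=> //; have [ij'|ij'] := eqVneq (i - 1) j; last first.
  by apply: (pm_singular hyq); rewrite ?eyq //=; lia.
have i0 : i = 0 by lia.
have f1 : g Bf *: m1 = 0 by have := f0; rewrite i0 expr1; apply.
apply: (@Defs.inc_inj _ _ _ _ E); rewrite linear0 -yqE.
have := gen_swap gE Bf Bp m1; rewrite /= f1 ypE yp0 linear0 !scaler0 scale0r add0r subr0.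
by move=> <-.
Qed.

End Ext1Cases.

(** * Gabriel quivers *)

Section GabrielQuiver.
Variables (K : numFieldType) (A : algType K) (g : sbasis -> A).
Hypothesis gE : enveloping g.
Local Notation wt i := (hvee K *~ i).
Variable N : int -> Prop.
Hypothesis Ndown : forall m n, m <= n -> N n -> N m.

(** The four families of arrows are disjoint, by the parity of j - i and by signs, so every count is
    0 or 1. *)
Lemma ext1_Gamma i j : N i -> N j ->
  ext1_dim (catN g N) (Lg g (wt i)) (Lg g (wt j)) (@arrows Gamma i j).
Proof.
move=> Ni Nj; have [u pmX] := L_model gE i; have [v pmY] := L_model gE j.
rewrite /=.
have [/andP[/eqP ij i1]|n1] := boolP ((j == i + 1) && (i != -1)).
  rewrite [X in ext1_dim _ _ _ X](_ : _ = 1%N); last by lia.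
  exact: (ext1_up gE Ndown pmX pmY Ni Nj ij i1).
have [/andP[/eqP ij i0]|n2] := boolP ((j == i - 1) && (i != 0)).
  rewrite [X in ext1_dim _ _ _ X](_ : _ = 1%N); last by lia.
  exact: (ext1_down gE Ndown pmX pmY Ni Nj ij i0).
have [/andP[i0 /eqP ij]|n3] := boolP ((0 <= i) && (j == - i - 2)).
  rewrite [X in ext1_dim _ _ _ X](_ : _ = 1%N); last by lia.
  exact: (ext1_verma gE Ndown pmX pmY Ni Nj i0 ij).
have [/andP[j0 /eqP ij]|n4] := boolP ((0 <= j) && (i == - j - 2)).
  rewrite [X in ext1_dim _ _ _ X](_ : _ = 1%N); last by lia.
  exact: (ext1_nabla gE Ndown pmX pmY Ni Nj j0 ij).
rewrite [X in ext1_dim _ _ _ X](_ : _ = 0%N); last by lia.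
exact: (ext1_split gE Ndown pmX pmY Ni Nj n1 n2 n3 n4).
Qed.

Lemma gabriel_catN (Q : quiver) (t : vertex Q -> int) : injective t ->
  (forall m, N m <-> exists x, t x = m) ->
  (forall x y, arrows x y = @arrows Gamma (t x) (t y)) ->
  gabriel_quiver (catN g N) (fun x => Lg g (wt (t x))).
Proof.
move=> tI tN tarr; have Nt x : N (t x) by apply/tN; exists x.
split=> [x|x y [f [f' fK _]]|M /(simple_classif gE)[m /tN[x <-] h]|x y].
- by have [u pm] := L_model gE (t x); exact: (L_simple gE Ndown pm (Nt x)).
- have [u pmX] := L_model gE (t x); have [v pmY] := L_model gE (t y).
  exact/tI/(L_iso_inj gE pmX pmY (can_inj fK)).
- by exists x.
- by rewrite tarr; exact: ext1_Gamma.
Qed.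

End GabrielQuiver.

(** * The categories attached to an integral coset of zero central charge *)

Section Cosets.
Variables (K : numFieldType) (xi : weight K -> Prop).
Hypotheses (xi_coset : is_coset xi) (xi_zero_charge : forall lam, xi lam -> lam.2 = 0)
  (xi_integral : exists2 lam, xi lam & exists n : int, lam.1 = n%:~R).

Lemma weight_wt (lam : weight K) (n : int) : xi lam -> lam.1 = n%:~R -> lam = hvee K *~ n.
Proof.
move=> /xi_zero_charge l2 l1; rewrite (hveeE K n).
by case: lam l1 l2 => a b /= -> ->.
Qed.

Lemma xiP mu : xi mu <-> exists k : int, mu = hvee K *~ k.
Proof.
have [lam xil [n ln]] := xi_integral; have [lam0 xiE] := xi_coset.
have le := weight_wt xil ln; have /xiE[k0 lk] := xil.
have e : lam0 = hvee K *~ (n - k0) by rewrite mulrzBr -le lk addrK.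
split=> [/xiE[k ->]|[k ->]].
  by exists (n - k0 + k); rewrite e [RHS]mulrzDr.
by apply/xiE; exists (k - (n - k0)); rewrite e -mulrzDr; congr (_ *~ _); lia.
Qed.

Lemma catO_xiE : catO_xi xi = catN (@sgen K) (fun=> True).
Proof.
apply/funext => M; apply/propext; split=> -[hO hs]; split=> // mu /hs.
  by move=> /xiP[k ->]; exists k.
by move=> [k _ ->]; apply/xiP; exists k.
Qed.

Lemma catO_xi_leE lam (n : int) : xi lam -> lam.1 = n%:~R ->
  catO_xi_le xi lam = catN (@sgen K) (fun m => m <= n).
Proof.
move=> xil ln; have le := weight_wt xil ln.
apply/funext => M; apply/propext; split=> [[[hO hs] hn]|[hO hs]].
  split=> // mu; case=> v [v0 hv].
  have /xiP[k mk] : xi mu by apply: hs; exists v.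
  exists k => //; rewrite leNgt; apply/negP => nk; case/eqP: v0.
  apply: (hn (k - n)); first by lia.
  by rewrite le -mulrzDr [n + _]addrC subrK -mk.
split; first by split=> // mu /hs[k _ ->]; apply/xiP; exists k.
move=> i v i1 hv; apply/eqP; apply: contraT => v0.
have [|m mn] := hs (lam + hvee K *~ i); first by exists v.
by rewrite le -mulrzDr => /hvee_inj; lia.
Qed.

Lemma gabriel_U (N : int -> Prop) (Q : quiver) (t : vertex Q -> int) :
  (forall m n, m <= n -> N n -> N m) -> injective t ->
  (forall m, N m <-> exists x, t x = m) ->
  (forall x y, arrows x y = @arrows Gamma (t x) (t y)) ->
  gabriel_quiver (catN (@sgen K) N) (fun x => L (hvee K *~ t x)).
Proof. by move=> Nd tI tN tarr; exact: (gabriel_catN (U_enveloping K) Nd tI tN tarr). Qed.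

Lemma gabriel_xi :
  (forall (lam : weight K) (n : int), xi lam -> lam.1 = n%:~R ->
     gabriel_quiver (catO_xi_le xi lam)
       (fun i : vertex (Gamma_le n) => L (hvee K *~ sval i))) /\
  gabriel_quiver (catO_xi xi) (fun i : vertex Gamma => L (hvee K *~ i)).
Proof.
split=> [lam n xil ln|].
  rewrite (catO_xi_leE xil ln); apply: (@gabriel_U _ (Gamma_le n) sval) => //.
  - by move=> a b ab bn; exact: le_trans ab bn.
  - exact: val_inj.
  - by move=> m; split=> [mn|[[x xn] <-]] //; exists (exist _ m mn).
by rewrite catO_xiE; apply: (@gabriel_U _ Gamma id) => // m; split=> // _; exists m.
Qed.

End Cosets.

Theorem proposition15 (R : realType) (xi : weight R[i] -> Prop)
  (xi_coset : is_coset xi)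
  (xi_zero_charge : forall lam, xi lam -> lam.2 = 0)
  (xi_integral : exists2 lam, xi lam & exists n : int, lam.1 = n%:~R) :
  (forall (lam : weight R[i]) (n : int), xi lam -> lam.1 = n%:~R ->
     gabriel_quiver (catO_xi_le xi lam)
       (fun i : vertex (Gamma_le n) => L (hvee R[i] *~ sval i))) /\
  gabriel_quiver (catO_xi xi) (fun i : vertex Gamma => L (hvee R[i] *~ i)).
Proof. exact: (gabriel_xi xi_coset xi_zero_charge xi_integral). Qed.
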